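(* Let $d\in\mathbb{N}$ with $d\ge 2$ and let $\rho:[0,1]^d\to[\tfrac43,\tfrac53]$ be a measurable function. Then there exists a repetitive Delone set $X\subset\mathbb{R}^d$ which encodes $\rho$ and has a repetitivity function $R:(0,\infty)\to(0,\infty)$ such that $$R(r)\in\bigcap_{q>\frac{2}{d}} o\left(r\left(\frac{\log r}{\log\log r}\right)^q\right),$$ i.e. for every real $q>\frac2d$ one has $\lim_{r\to\infty} R(r)\Big/\left(r\left(\frac{\log r}{\log\log r}\right)^q\right)=0$.
   Context: $\mathbb{R}^d$ carries the Euclidean metric; $B(x,r)$ is the open Euclidean ball of radius $r>0$ centred at $x$; $\mathcal{L}$ is Lebesgue measure. Delone set: a discrete set $X\subset\mathbb{R}^d$ such that (uniform discreteness) there is $r>0$ such that every ball of radius $r$ in $\mathbb{R}^d$ contains at most one point of $X$, and (relative density) there is $R>0$ such that every ball of radius $R$ in $\mathbb{R}^d$ contains at least one point of $X$. Repetitivity: for $x\in X$ and $r>0$ the $r$-patch centred at $x$ is $\mathcal{P}_{x,r}:=X\cap B(x,r)$. An $X$-translate of $\mathcal{P}_{x,r}$ is an $r$-patch $\mathcal{P}_{y,r}$ with $y\in X$ and $\mathcal{P}_{y,r}=y-x+\mathcal{P}_{x,r}$. Given a non-decreasing function $R:(0,\infty)\to(0,\infty)$, $X$ is $R(r)$-repetitive, and $R$ is called a repetitivity function of $X$, if for each $r>0$, each $x\in X$ and each $y\in\mathbb{R}^d$, an $X$-translate of $\mathcal{P}_{x,r}$ intersects $B(y,R(r))$. $X$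 is repetitive if it has a repetitivity function. Encoding: a Delone set $X\subset\mathbb{R}^d$ encodes a measurable function $\rho:[0,1]^d\to\mathbb{R}_{>0}$ if there exist a sequence $r_n\to\infty$ of positive reals, a sequence of closed cubes $Q_n\subset\mathbb{R}^d$ with sidelength $r_n$, and a sequence of bijective affine maps $\varphi_n:[0,1]^d\to Q_n$ such that the measures $\mu_n(A):=\frac{|X\cap\varphi_n(A)|}{r_n^d}$, $A\subseteq[0,1]^d$, satisfy $\mu_n\rightharpoonup\rho\mathcal{L}$ on $[0,1]^d$, where $\rho\mathcal{L}(A)=\int_A\rho\,d\mathcal{L}$ and $\rightharpoonup$ is weak convergence (convergence of integrals of all bounded continuous functions $[0,1]^d\to\mathbb{R}$). *)

(* Defs.v *)
From HB Require Import structures.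
From mathcomp Require Import all_boot all_order all_algebra.
From mathcomp Require Import all_classical all_reals all_analysis.

Set Implicit Arguments.
Unset Strict Implicit.
Unset Printing Implicit Defensive.
Import Order.TTheory GRing.Theory Num.Theory.
Import numFieldNormedType.Exports.

Local Open Scope classical_set_scope.
Local Open Scope ring_scope.

(* The product (= Borel) sigma-algebra on 'rV[R]_n, generated by the
   coordinate maps. *)
Section measurable_rV.
Variables (R : realType) (n : nat).

Definition rV_coord (i : 'I_n) (x : 'rV[R]_n) : R := x ord0 i.

Let rV_set0 : g_sigma_preimage rV_coord set0.
Proof. exact: sigma_algebra0. Qed.

Let rV_setC A : g_sigma_preimage rV_coord A -> g_sigma_preimage rV_coord (~` A).
Proof. exact: sigma_algebraC. Qed.

Let rV_bigcup (F : _^nat) : (forall i, g_sigma_preimage rV_coord (F i)) ->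
  g_sigma_preimage rV_coord (\bigcup_i (F i)).
Proof. exact: sigma_algebra_bigcup. Qed.

HB.instance Definition _ := @isMeasurable.Build
  (measure_tuple_display default_measure_display)
  'rV[R]_n (g_sigma_preimage rV_coord) rV_set0 rV_setC rV_bigcup.

End measurable_rV.

Section rV_measurability.
Variable R : realType.

Lemma measurable_rV_coord n (i : 'I_n) :
  measurable_fun [set: 'rV[R]_n] (@rV_coord R n i).
Proof.
move=> _ Y mY; rewrite setTI; apply: sub_sigma_algebra.
by rewrite (bigD1 i)//=; left; exists Y; rewrite ?setTI.
Qed.

Lemma measurable_fun_rV d (T : measurableType d) n (f : T -> 'rV[R]_n) :
  (forall i, measurable_fun [set: T] (fun x => f x ord0 i)) ->
  measurable_fun [set: T] f.
Proof.
move=> mf; apply: (@measurability _ _ _ _ [set: T] f) => //.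
move=> _ [B + <-]; rewrite setTI.
elim/big_ind : _ => [//|A1 A2 h1 h2 [/h1//|/h2//]|i _ [C mC <-]].
by rewrite setTI -[X in measurable X]setTI; exact: mf.
Qed.

Definition rV_cons n (p : R * 'rV[R]_n) : 'rV[R]_n.+1 :=
  row_mx (const_mx p.1 : 'rV_1) p.2.

Definition rV_uncons n (x : 'rV[R]_n.+1) : R * 'rV[R]_n :=
  (x ord0 ord0, rsubmx (x : 'rV_(1 + n))).

Lemma rV_consK n : cancel (@rV_cons n) (@rV_uncons n).
Proof.
case=> a x; rewrite /rV_uncons /rV_cons row_mxKr; congr pair.
rewrite [LHS](_ : _ = row_mx (const_mx a : 'rV_1) x ord0 (lshift n ord0)).
  by rewrite row_mxEl mxE.
by congr (row_mx _ _ _ _); exact/val_inj.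
Qed.

Lemma measurable_rV_cons n : measurable_fun setT (@rV_cons n).
Proof.
apply: measurable_fun_rV => i.
rewrite -(splitK (i : 'I_(1 + n))).
case: (fintype.split (i : 'I_(1 + n))) => j /=.
  rewrite (_ : (fun _ => _) = fst); first exact: measurable_fst.
  by apply/funext => p; rewrite /rV_cons (@row_mxEl R 1 1 n) mxE.
rewrite (_ : (fun _ => _) = @rV_coord R n j \o snd); last first.
  by apply/funext => p; rewrite /rV_cons (@row_mxEr R 1 1 n).
exact: (measurableT_comp (measurable_rV_coord j)).
Qed.

Lemma measurable_rV_uncons n : measurable_fun setT (@rV_uncons n).
Proof.
apply/measurable_fun_pairP; split; first exact: measurable_rV_coord.
apply: measurable_fun_rV => i /=.
by under eq_fun do rewrite mxE; exact: measurable_rV_coord.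
Qed.

End rV_measurability.

Section rV_cons_measure.
Local Open Scope ereal_scope.
Variables (R : realType) (n : nat).
Variable m : {sigma_finite_measure set 'rV[R]_n -> \bar R}.

(* The product of 1-dimensional Lebesgue measure with m, transported to
   'rV_n.+1. *)
Definition rV_cons_measure : set 'rV[R]_n.+1 -> \bar R :=
  pushforward (@lebesgue_measure R \x m) (@rV_cons R n).

Let measure0 : rV_cons_measure set0 = 0.
Proof. by rewrite /rV_cons_measure /pushforward preimage_set0 measure0. Qed.

Let measure_ge0 A : 0 <= rV_cons_measure A.
Proof. exact: (@measure_ge0 _ _ _ (lebesgue_measure \x m)). Qed.

Let measure_sigma_additive : semi_sigma_additive rV_cons_measure.
Proof.
have mcons A : measurable A -> measurable (@rV_cons R n @^-1` A).
  by move=> mA; rewrite -[X in measurable X]setTI; exact: measurable_rV_cons.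
move=> F mF tF mUF; rewrite /rV_cons_measure /pushforward preimage_bigcup.
apply: measure_semi_sigma_additive => [k||]; first exact: mcons.
- apply/trivIsetP => /= i j _ _ ij; rewrite -preimage_setI.
  by move/trivIsetP : tF => /(_ _ _ _ _ ij) ->//; rewrite preimage_set0.
- by rewrite -preimage_bigcup; exact: mcons.
Qed.

HB.instance Definition _ := isMeasure.Build _ _ _ rV_cons_measure
  measure0 measure_ge0 measure_sigma_additive.

Let measure_sigma_finite : sigma_finite setT rV_cons_measure.
Proof.
have /sigma_finiteP[F [TF ndF Foo]] := sigma_finiteT (@lebesgue_measure R).
have /sigma_finiteP[G [TG ndG Goo]] := sigma_finiteT m.
exists (fun k => @rV_uncons R n @^-1` (F k `*` G k)).
  rewrite -preimage_bigcup (_ : \bigcup_k _ = setT) ?preimage_setT//.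
  rewrite -subTset => -[a x] _.
  have [i _ Fia] : (\bigcup_i F i) a by rewrite -TF.
  have [j _ Gjx] : (\bigcup_i G i) x by rewrite -TG.
  exists (maxn i j) => //; split => /=.
    by move: a Fia; exact/subsetPset/ndF/leq_maxl.
  by move: x Gjx; exact/subsetPset/ndG/leq_maxr.
move=> k; have [mFk Fk] := Foo k; have [mGk Gk] := Goo k; split.
  by rewrite -[X in measurable X]setTI; apply: measurable_rV_uncons => //;
    exact: measurableX.
rewrite /rV_cons_measure /pushforward -comp_preimage.
rewrite (_ : _ \o _ = id); last by apply/funext => x /=; rewrite rV_consK.
by rewrite preimage_id product_measure1E// lte_mul_pinfty// ge0_fin_numE.
Qed.

HB.instance Definition _ := @Measure_isSigmaFinite.Build _ _ _ rV_cons_measure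
  measure_sigma_finite.

End rV_cons_measure.

Fixpoint borel_lebesgue_rV (R : realType) (n : nat) :
    {sigma_finite_measure set 'rV[R]_n -> \bar R} :=
  if n is n'.+1 then rV_cons_measure (borel_lebesgue_rV R n')
  else @dirac _ _ (0 : 'rV[R]_0) R.

(* R^d with the sigma-algebra of Lebesgue measurable sets (those that are
   Caratheodory measurable for the Lebesgue outer measure). *)
Definition lebesgueType (R : realType) (d : nat) : measurableType _ :=
  caratheodory_type ((borel_lebesgue_rV R d)^*)%mu.

Definition lebesgue (R : realType) (d : nat) :
    {measure set (lebesgueType R d) -> \bar R} :=
  @completed_measure_extension _ _ _ (borel_lebesgue_rV R d).

Section euclidean.
Variables (R : realType) (d : nat).
Implicit Types (x y : 'rV[R]_d) (r : R) (X Q : set 'rV[R]_d).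

(* The library norm on 'rV[R]_d is the maximum norm (its topology is the
   Euclidean one). *)
Definition enorm x : R := Num.sqrt (\sum_i x ord0 i ^+ 2).

Definition eball x r : set 'rV[R]_d := [set y | enorm (y - x) < r].

Definition uniformly_discrete X :=
  exists2 r, 0 < r & forall c, is_subset1 (X `&` eball c r).

Definition relatively_dense X :=
  exists2 r, 0 < r & forall c, X `&` eball c r !=set0.

Definition delone X :=
  [/\ X `<=` isolated X, uniformly_discrete X & relatively_dense X].

Definition patch X x r : set 'rV[R]_d := X `&` eball x r.

Definition patch_translate X x y r :=
  X y /\ patch X y r = (fun z => y - x + z) @` patch X x r.

(* Only the values of Rf on ]0, +oo[ are constrained. *)
Definition repetitivity_function X (Rf : R -> R) :=
  [/\ forall r, 0 < r -> 0 < Rf r,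
      forall r s, 0 < r -> r <= s -> Rf r <= Rf s
    & forall r, 0 < r -> forall x, X x -> forall y,
        exists2 z, patch_translate X x z r &
          patch X z r `&` eball y (Rf r) !=set0].

Definition repetitive X := exists Rf, repetitivity_function X Rf.

Definition cube r : set 'rV[R]_d := [set x | forall i, 0 <= x ord0 i <= r].

(* Cubes are not required to be axis-parallel: a cube of sidelength r is the
   image of [0, r]^d under a Euclidean isometry. *)
Definition closed_cube r Q :=
  exists p (U : 'M[R]_d), U *m U^T = 1%:M /\ Q = (fun t => p + t *m U) @` cube r.

Definition affine_on (A : set 'rV[R]_d) (phi : 'rV[R]_d -> 'rV[R]_d) :=
  exists (M : 'M[R]_d) b, forall x, A x -> phi x = x *m M + b.

End euclidean.

Arguments cube {R} d r.

Section encoding.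
Local Open Scope ereal_scope.
Variables (R : realType) (d : nat).
Notation T := (lebesgueType R d).

Definition weakly_converges_on (D : set T) (mu_ : nat -> set T -> \bar R)
    (nu : set T -> \bar R) :=
  forall f : 'rV[R]_d -> R,
    {within (D : set 'rV[R]_d), continuous f} ->
    [bounded f x | x in (D : set 'rV[R]_d)] ->
    \int[mu_ n]_(x in D) (f x)%:E @[n --> \oo] --> \int[nu]_(x in D) (f x)%:E.

(* A |-> |X `&` phi(A)| / r^d, as a set function concentrated on [0, 1]^d *)
Definition scaled_count (X : set 'rV[R]_d) (phi : 'rV[R]_d -> 'rV[R]_d) (r : R)
    (A : set T) : \bar R :=
  counting (X `&` phi @` (A `&` cube d 1)) * ((r ^+ d)^-1)%:E.

(* rho L, as a set function concentrated on [0, 1]^d *)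
Definition density_measure (rho : T -> R) (A : set T) : \bar R :=
  \int[@lebesgue R d]_(x in A `&` cube d 1) (rho x)%:E.

Definition encodes (X : set 'rV[R]_d) (rho : T -> R) :=
  exists (r_ : nat -> R) (Q_ : nat -> set 'rV[R]_d)
      (phi_ : nat -> 'rV[R]_d -> 'rV[R]_d),
    [/\ (forall n, 0 < r_ n)%R,
        r_ n @[n --> \oo] --> +oo%R,
        forall n, closed_cube (r_ n) (Q_ n),
        forall n, affine_on (cube d 1) (phi_ n) /\
          set_bij (cube d 1) (Q_ n) (phi_ n)
      & weakly_converges_on (cube d 1)
          (fun n => scaled_count X (phi_ n) (r_ n)) (density_measure rho)].

End encoding.

(* Main.v *)
Require Import Defs.
From mathcomp Require Import all_boot all_order all_algebra.
From mathcomp Require Import finmap.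
From mathcomp Require Import all_classical all_reals all_analysis.
From mathcomp Require Import measurable_realfun zify lra ring.
From HB Require Import structures.

Set Implicit Arguments.
Unset Strict Implicit.
Unset Printing Implicit Defensive.
Import Order.TTheory GRing.Theory Num.Theory.
Import numFieldNormedType.Exports.

Local Open Scope classical_set_scope.
Local Open Scope ring_scope.

(* X consists of the points z + (1/3, ..., 1/3), z in Z^d, together with the
   points z + (2/3, ..., 2/3) for those z with w z = true, where
   w : Z^d -> bool is a hierarchical (Toeplitz-like) colouring.  A level-(n+1)
   block is an array of N_n^d level-n blocks.  At every level there are three
   types of blocks: one of low density (at most 1/3), one of high density (at
   least 2/3), and a mixed one that imitates rho at resolution sqrt(N_n).  In
   every level-(n+1) block a bounded number K of positions, the same for all
   three types, is reserved for displaying all clusters of 2^d adjacent level-n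
   blocks; a patch of radius r lies in such a cluster once the side L_n of the
   level-n blocks exceeds 2r + 1, so R(r) is of order L_(n+1) for the least such
   n, and R(r)/r is bounded by a multiple of N_(n-1) N_n.  The reserved positions
   change the densities by at most sum_n K/N_n^d, which stays below 1/3 for
   N_n^d of order n (ln n)^2; as L_n is then at least (n!)^(1/d),
   n = O(ln r / ln ln r) and the exponent 2/d appears.  In the mixed block the
   choice between low and high subblocks is made greedily in each of the
   N_n^(d/2) coarse cells, so that its mass there is that of rho up to a bounded
   number of subblocks. *)

(** * Integer boxes and the hierarchical colouring *)

Section IntegerBoxes.
Variable d : nat.
Implicit Types (z k u : 'rV[int]_d) (L m n : nat).

Definition vdiv L z : 'rV[int]_d := \row_i (z ord0 i %/ L)%Z.
Definition vmod L z : 'rV[int]_d := \row_i (z ord0 i %% L)%Z.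
(** Finite functions index the box [0, n)^d, so that sums over it are big operators over a finite
    type. *)
Definition box_pt n (v : {ffun 'I_d -> 'I_n}) : 'rV[int]_d :=
  \row_i (v i : nat)%:Z.

Lemma vdivE L z i : vdiv L z ord0 i = (z ord0 i %/ L)%Z.
Proof. by rewrite mxE. Qed.

Lemma vdiv_eq L z : z = L%:Z *: vdiv L z + vmod L z.
Proof. by apply/rowP => i; rewrite !mxE mulrC -divz_eq. Qed.

Lemma vdivD L k u : (0 < L)%N -> vdiv L (L%:Z *: k + u) = k + vdiv L u.
Proof. by move=> L0; apply/rowP => i; rewrite !mxE mulrC divzMDl//; lia. Qed.

Lemma vmodD L k u : vmod L (L%:Z *: k + u) = vmod L u.
Proof. by apply/rowP => i; rewrite !mxE mulrC modzMDl. Qed.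

Lemma vdiv_small L z : (forall i, 0 <= z ord0 i < L%:Z) -> vdiv L z = 0.
Proof. by move=> zL; apply/rowP => i; rewrite !mxE divz_small. Qed.

Lemma vmod_small L z : (forall i, 0 <= z ord0 i < L%:Z) -> vmod L z = z.
Proof. by move=> zL; apply/rowP => i; rewrite !mxE modz_small. Qed.

Lemma vmod_itv L z i : (0 < L)%N -> 0 <= vmod L z ord0 i < L%:Z.
Proof. by move=> L0; rewrite mxE modz_ge0 ?ltz_pmod//; lia. Qed.

Lemma box_pt_itv n (v : {ffun 'I_d -> 'I_n}) i : 0 <= box_pt v ord0 i < n%:Z.
Proof. by rewrite mxE /=; have := ltn_ord (v i); lia. Qed.

Lemma vdiv_box n (v : {ffun 'I_d -> 'I_n}) : vdiv n (box_pt v) = 0.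
Proof. exact/vdiv_small/box_pt_itv. Qed.

Lemma vmod_box n (v : {ffun 'I_d -> 'I_n}) : vmod n (box_pt v) = box_pt v.
Proof. exact/vmod_small/box_pt_itv. Qed.

Lemma vdivM m n z : vdiv (n * m) z = vdiv n (vdiv m z).
Proof. by apply/rowP => i; rewrite !mxE mulnC PoszM divzMA_ge0. Qed.

Lemma box_pt_inj n : injective (@box_pt n).
Proof.
move=> u v /rowP uv; apply/ffunP => i; apply/val_inj.
by have := uv i; rewrite !mxE => -[].
Qed.

(** Coordinatewise Euclidean division by [L] is a bijection between the large box and pairs (block,
    position in the block). *)
Lemma sum_box_mul (V : nmodType) n L (F : 'rV[int]_d -> V) : (0 < L)%N ->
  \sum_(v : {ffun 'I_d -> 'I_(n * L)}) F (box_pt v) =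
  \sum_(x : {ffun 'I_d -> 'I_n}) \sum_(y : {ffun 'I_d -> 'I_L})
    F (L%:Z *: box_pt x + box_pt y).
Proof.
move=> L0; rewrite pair_big/=.
have lt_mul (x : 'I_n) (y : 'I_L) : (x * L + y < n * L)%N.
  by have := ltn_ord x; have := ltn_ord y; nia.
have lt_div (v : 'I_(n * L)) : (v %/ L < n)%N.
  by rewrite ltn_divLR.
have lt_mod (v : 'I_(n * L)) : (v %% L < L)%N by rewrite ltn_mod.
pose h (p : {ffun 'I_d -> 'I_n} * {ffun 'I_d -> 'I_L}) :
    {ffun 'I_d -> 'I_(n * L)} :=
  [ffun i => Ordinal (lt_mul (p.1 i) (p.2 i))].
pose g (v : {ffun 'I_d -> 'I_(n * L)}) :
    {ffun 'I_d -> 'I_n} * {ffun 'I_d -> 'I_L} :=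
  ([ffun i => Ordinal (lt_div (v i))], [ffun i => Ordinal (lt_mod (v i))]).
rewrite (reindex h)/=; last first.
  exists g => [[x y] _|v _].
    congr pair; apply/ffunP => i; rewrite !ffunE; apply/val_inj => /=.
      by rewrite divnMDl// divn_small ?addn0.
    by rewrite modnMDl modn_small.
  by apply/ffunP => i; rewrite !ffunE; apply/val_inj => /=;
    rewrite -divn_eq.
apply: eq_bigr => -[x y] _; congr F; apply/rowP => i.
by rewrite !mxE ffunE/= PoszD PoszM mulrC.
Qed.

End IntegerBoxes.

(** * Reserved positions in a block *)

Section Reserved.
Variable d : nat.

(* [Some false] and [Some true] are the tiles of low and high density, [None]
   is the tile carrying an approximation of the density to be encoded. *)
Definition tile := option bool.

Definition corner := {ffun 'I_d -> bool}.
Definition tile_cluster := {ffun corner -> tile}.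
Definition corner_pt (e : corner) : 'rV[int]_d := \row_i (e i : nat)%:Z.

(* A slot [(Some c, e)] is the corner [e] of the copy of the cluster [c];
   a slot [(None, e)] is the corner [e] of the whole box [0, N)^d. *)
Definition slot := (option tile_cluster * corner)%type.

(** The cluster of rank c occupies the 2 x ... x 2 cube with coordinates 2c+1 and 2c+2 on the
    diagonal. These cubes are disjoint and, once [big_enough] holds, stay strictly between the
    extreme coordinates 0 and N-1 used by the corners of the box. *)
Definition slot_pos (N : nat) (s : slot) : 'rV[int]_d :=
  \row_i (match s.1 with
          | Some c => (enum_rank c).*2.+1 + s.2 i
          | None => if s.2 i then N.-1 else 0
          end)%N%:Z.

(** Low tiles at the corners of the box make the low blocks of successive levels agree around the
    origin, which gives a limit colouring ([colouringE]). *)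
Definition slot_tile (s : slot) : tile :=
  if s.1 is Some c then c s.2 else Some false.

Definition reserved (N : nat) (x : 'rV[int]_d) : option tile :=
  omap slot_tile [pick s | slot_pos N s == x].

Definition big_enough (N : nat) := (#|{: tile_cluster}|.*2.+1 < N)%N.

Hypothesis d_gt0 : (0 < d)%N.

Lemma cluster_rank_lt N (c : tile_cluster) :
  big_enough N -> ((enum_rank c).*2.+3 < N)%N.
Proof. by apply: leq_ltn_trans; rewrite ltnS -doubleS leq_double ltn_ord. Qed.

Lemma slot_pos_inj N : big_enough N -> injective (slot_pos N).
Proof.
move=> NM [a e] [b e'] /rowP E.
have Ei i := E i.
case: a E Ei => [a|]; case: b => [b|] E Ei.
- have ab : a = b.
    apply/enum_rank_inj/val_inj/eqP; have := Ei (Ordinal d_gt0).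
    by rewrite !mxE/=; lia.
  subst b; congr pair; apply/ffunP => i; have := Ei i; rewrite !mxE/= => -[].
  by case: (e i) (e' i) => -[]//= ?; exfalso; lia.
- have := Ei (Ordinal d_gt0); have := cluster_rank_lt a NM.
  by rewrite !mxE/=; case: (e _) (e' _) => -[]; lia.
- have := Ei (Ordinal d_gt0); have := cluster_rank_lt b NM.
  by rewrite !mxE/=; case: (e _) (e' _) => -[]; lia.
- congr pair; apply/ffunP => i; have := Ei i; rewrite !mxE/= => -[].
  by move: NM; rewrite /big_enough; case: (e i) (e' i) => -[]//= ? ?; exfalso; lia.
Qed.

Lemma reserved_slot N s : big_enough N ->
  reserved N (slot_pos N s) = Some (slot_tile s).
Proof.
move=> NM; rewrite /reserved; case: pickP => [s' /eqP/slot_pos_inj ->//|].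
by move=> /(_ s); rewrite eqxx.
Qed.

Lemma slot_pos_itv N s i : big_enough N -> 0 <= slot_pos N s ord0 i < N%:Z.
Proof.
move=> NM; rewrite mxE; case: s => [[c|] e]/=.
  rewrite ltz_nat (leq_ltn_trans _ (cluster_rank_lt c NM))//.
  by case: (e i); rewrite /= ?addn0 ?addn1 !ltnS// leqW.
by move: NM; rewrite /big_enough; case: (e i); lia.
Qed.

Lemma slot_pos_cluster N c e :
  slot_pos N (Some c, e) = slot_pos N (Some c, [ffun=> false]) + corner_pt e.
Proof. by apply/rowP => i; rewrite !mxE/= ffunE/= addn0 PoszD. Qed.

(** A reserved position is the position of some slot, hence a bound independent of [N]. *)
Lemma card_reserved N :
  (#|[pred v : {ffun 'I_d -> 'I_N} | reserved N (box_pt v)]| <= #|{: slot}|)%N.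
Proof.
case: N => [|N].
  rewrite eq_card0// => v; by have := v (Ordinal d_gt0) => -[].
pose f (s : slot) : {ffun 'I_d -> 'I_N.+1} :=
  [ffun i => inord `|slot_pos N.+1 s ord0 i|].
apply: leq_trans (leq_image_card f predT).
apply/subset_leq_card/fintype.subsetP => v; rewrite inE /reserved.
case: pickP => // s /eqP sv _; suff -> : v = f s by exact: codom_f.
by apply/ffunP => i; rewrite ffunE sv mxE absz_nat inord_val.
Qed.

End Reserved.

(** * The hierarchy of blocks and its limit colouring *)

Section Hierarchy.
Variables (d : nat) (N : nat -> nat).
(** The choice between low and high subblocks in a mixed block. It receives the colourings of the
    level-n blocks because it will depend on their densities. *)
Variable pat : nat -> (tile -> 'rV[int]_d -> bool) -> 'rV[int]_d -> bool.
Hypothesis N_big : forall n, big_enough d (N n).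
Implicit Types (z k : 'rV[int]_d) (t : tile).

Fixpoint side n := if n is m.+1 then (N m * side m)%N else 1%N.

Definition subtile n (c : tile -> 'rV[int]_d -> bool) t x : tile :=
  if reserved (N n) x is Some t' then t'
  else if t is Some b then Some b else Some (pat n c x).

(** A block is given as a colouring of all of Z^d with period [side n] in each direction
    ([block_period]). At level 0 the mixed tile counts as low. *)
Fixpoint block n t z : bool :=
  if n is m.+1 then
    block m (subtile m (block m) t (vmod (N m) (vdiv (side m) z))) z
  else t == Some true.

(** The level l = sum |z_i| is high enough: |z_i| <= l < [side l], so z lies in one of the 2^d
    level-l blocks meeting at the origin. *)
Definition colouring z : bool := block (\sum_i `|z ord0 i|)%N (Some false) z.

Lemma branch_gt1 n : (1 < N n)%N.
Proof. exact: leq_ltn_trans (N_big n). Qed.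

Lemma side_gt n : (n < side n)%N.
Proof. by elim: n => //= n IH; have := branch_gt1 n; nia. Qed.

Lemma side_gt0 n : (0 < side n)%N.
Proof. exact: leq_trans (side_gt n). Qed.

Lemma side_le m n : (m <= n)%N -> (side m <= side n)%N.
Proof.
elim: n => [|n IH]; first by rewrite leqn0 => /eqP ->.
rewrite leq_eqVlt => /predU1P[->//|]; rewrite ltnS => /IH /leq_trans; apply.
by rewrite /= leq_pmull// (ltn_trans _ (branch_gt1 n)).
Qed.

Lemma sideD n m : exists P, side (n + m) = (P * side n)%N.
Proof.
elim: m => [|m [P E]]; first by exists 1%N; rewrite addn0 mul1n.
by exists (N (n + m) * P)%N; rewrite addnS/= E mulnA.
Qed.

Lemma block_period n t k z : block n t ((side n)%:Z *: k + z) = block n t z.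
Proof.
elim: n t k z => //= n IH t k z.
rewrite PoszM [_ * _%:Z]mulrC -scalerA vdivD ?side_gt0// vmodD IH.
by [].
Qed.

Hypothesis d_gt0 : (0 < d)%N.

(** The 2^d level-m blocks around the origin sit, modulo the period, at the corners of a low
    level-(m+1) block, and these are reserved for low tiles. Hence passing from level m to m+1
    changes nothing there. *)
Lemma colouringE n z : (forall i, (`|z ord0 i| < side n)%N) ->
  colouring z = block n (Some false) z.
Proof.
have stab m : (forall i, (`|z ord0 i| < side m)%N) ->
    block m.+1 (Some false) z = block m (Some false) z.
  move=> zm /=; congr block; set x := vmod _ _.
  pose e : corner d := [ffun i => z ord0 i < 0].
  (* A negative coordinate has block index -1, which is N-1 modulo N; a nonnegative one has index
     0. *)
  have -> : x = slot_pos (N m) (None, e).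
    apply/rowP => i; rewrite !mxE/= ffunE; have := zm i.
    have N1 := branch_gt1 m; have [z0|z0] := ltP (z ord0 i) 0 => zim.
      rewrite (_ : (_ %/ _)%Z = -1).
        by rewrite -[-1]addr0 -(modzDl _ (N m)) modz_small; lia.
      have -> : z ord0 i = (-1) * (side m)%:Z + ((side m)%:Z + z ord0 i) by lia.
      by rewrite divzMDl ?divz_small; lia.
    by rewrite divz_small ?mod0z; lia.
  by rewrite /subtile reserved_slot.
have stabD m p : (forall i, (`|z ord0 i| < side m)%N) ->
    block (m + p) (Some false) z = block m (Some false) z.
  move=> zm; elim: p => [|p IH]; rewrite ?addn0// addnS stab ?IH// => i.
  exact/(leq_trans (zm i))/side_le/leq_addr.
move=> zn; rewrite /colouring; set l := (\sum_i _)%N.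
have zl i : (`|z ord0 i| < side l)%N.
  by rewrite (leq_ltn_trans _ (side_gt _))// /l (bigD1 i)//= leq_addr.
have [ln|/ltnW nl] := leqP l n; first by rewrite -(subnKC ln) stabD.
by rewrite -(subnKC nl) stabD.
Qed.

(** All points of the level-n block at k lie in the same block of each higher level, so descending
    the hierarchy reaches one common tile. *)
Lemma block_tile n m t k : exists t', forall z, vdiv (side n) z = k ->
  block (n + m) t z = block n t' z.
Proof.
elim: m t => [|m IH] t; first by exists t => z _; rewrite addn0.
have [P E] := sideD n m.
have [t' t'E] := IH (subtile (n + m) (block (n + m)) t
  (vmod (N (n + m)) (vdiv P k))).
by exists t' => z zk; rewrite addnS/= E vdivM zk t'E.
Qed.

Lemma colouring_tile n k : exists t, forall z, vdiv (side n) z = k ->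
  colouring z = block n t z.
Proof.
(* [m] bounds every |z_i| on the block at k, so that [colouringE] applies at level n + m. *)
pose m := (side n * (\sum_i `|k ord0 i|).+1)%N.
have [t tE] := block_tile n m (Some false) k.
exists t => z zk; rewrite -tE//; apply: colouringE => i.
rewrite (leq_ltn_trans _ (side_gt _))// (leq_trans _ (leq_addl _ _))//.
rewrite (vdiv_eq (side n) z) zk mxE.
have := vmod_itv z i (side_gt0 n); have := side_gt0 n.
have : (`|k ord0 i| <= \sum_i `|k ord0 i|)%N by rewrite (bigD1 i)//= leq_addr.
rewrite /m !mxE; set s := (\sum_i _)%N; set u := (_ %% _)%Z.
move=> ks S0 uS; rewrite mulnS addnC.
apply: (@leq_trans (side n * `|k ord0 i| + `|u|)%N).
  by rewrite -[X in (_ <= X * _ + _)%N]absz_nat -abszM; clearbody u;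
    move: ((side n)%:Z * k ord0 i) => p; lia.
by rewrite leq_add// ?leq_mul//; lia.
Qed.

Lemma block_sub n t k (x : 'rV[int]_d) : (forall i, 0 <= x ord0 i < (N n)%:Z) ->
  forall z, vdiv (side n) z = (N n)%:Z *: k + x ->
  block n.+1 t z = block n (subtile n (block n) t x) z.
Proof. by move=> xN z /= ->; rewrite vmodD vmod_small. Qed.

(* The slots of the level-(n+1) block [k'] display all clusters, in particular
   that of the 2^d level-n blocks at [k]. *)
Lemma colouring_recur n k k' : exists p,
  (forall e : corner d, vdiv (N n) (p + corner_pt e) = k') /\
  (forall (e : corner d) z, vdiv (side n) z = k + corner_pt e ->
    colouring ((side n)%:Z *: (p - k) + z) = colouring z).
Proof.
have [tau tauE] := choice (colouring_tile n).
pose c : tile_cluster d := [ffun e => tau (k + corner_pt e)].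
pose pos e := slot_pos (N n) (Some c, e).
have posE e : pos e = pos [ffun=> false] + corner_pt e.
  exact: slot_pos_cluster.
have N0 : (0 < N n)%N by rewrite (ltn_trans _ (branch_gt1 n)).
exists ((N n)%:Z *: k' + pos [ffun=> false]); split=> [e|e z ze].
  rewrite -addrA -posE vdivD// vdiv_small ?addr0// => i; exact: slot_pos_itv.
(* The tile [T] of the block at k' is arbitrary: reserved positions look the same in all three
   types. *)
have [T TE] := colouring_tile n.+1 k'.
have divE : vdiv (side n) ((side n)%:Z *: ((N n)%:Z *: k'
    + pos [ffun=> false] - k) + z) = (N n)%:Z *: k' + pos e.
  by rewrite vdivD ?side_gt0// ze subrKA -addrA -posE.
rewrite TE; last first.
  rewrite /= vdivM divE vdivD// vdiv_small ?addr0// => i; exact: slot_pos_itv.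
rewrite (block_sub _ _ divE); last by move=> i; exact: slot_pos_itv.
by rewrite block_period /subtile reserved_slot//= /slot_tile/= ffunE -tauE.
Qed.

(** The constant cluster with value t is among those displayed in the level-(n+1) block at 0. For t
    = [None] this provides the mixed blocks along which rho is encoded. *)
Lemma colouring_has_tile n t : exists k, forall z, vdiv (side n) z = k ->
  colouring z = block n t z.
Proof.
pose s : slot d := (Some [ffun=> t], [ffun=> false]).
have sN i : 0 <= slot_pos (N n) s ord0 i < (N n)%:Z by exact: slot_pos_itv.
exists (slot_pos (N n) s) => z zs.
have [T TE] := colouring_tile n.+1 0.
rewrite TE; last by rewrite /= vdivM zs vdiv_small.
rewrite (@block_sub n T 0 (slot_pos (N n) s))//.
  by rewrite /subtile reserved_slot//= /slot_tile/= ffunE.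
by rewrite scaler0 add0r.
Qed.

Definition block_count n t : nat :=
  (\sum_(v : {ffun 'I_d -> 'I_(side n)}) block n t (box_pt v))%N.

Lemma block_count_le n t : (block_count n t <= side n ^ d)%N.
Proof.
have : (block_count n t <= \sum_(v : {ffun 'I_d -> 'I_(side n)}) 1)%N.
  by apply: leq_sum => v _; case: block.
by rewrite sum1_card card_ffun !card_ord.
Qed.

Lemma block_subE n t (x : {ffun 'I_d -> 'I_(N n)})
    (y : {ffun 'I_d -> 'I_(side n)}) :
  block n.+1 t ((side n)%:Z *: box_pt x + box_pt y) =
  block n (subtile n (block n) t (box_pt x)) (box_pt y).
Proof.
rewrite (@block_sub n t 0 (box_pt x)); last 2 first.
- exact: box_pt_itv.
- by rewrite vdivD ?side_gt0// vdiv_box scaler0 add0r addr0.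
by rewrite block_period.
Qed.

Lemma block_countS n t : block_count n.+1 t =
  (\sum_(x : {ffun 'I_d -> 'I_(N n)})
    block_count n (subtile n (block n) t (box_pt x)))%N.
Proof.
rewrite /block_count (sum_box_mul (N n) (fun v => (block n.+1 t v : nat))).
  by apply: eq_bigr => x _; apply: eq_bigr => y _; rewrite block_subE.
exact: side_gt0.
Qed.

Lemma sum_reserved_le n (f : {ffun 'I_d -> 'I_(N n)} -> tile) :
  (\sum_(x | reserved (N n) (box_pt x)) block_count n (f x) <=
   #|{: slot d}| * side n ^ d)%N.
Proof.
have : (\sum_(x | reserved (N n) (box_pt x)) block_count n (f x) <=
    \sum_(x : {ffun 'I_d -> 'I_(N n)} | reserved (N n) (box_pt x))
      side n ^ d)%N.
  by apply: leq_sum => x _; exact: block_count_le.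
move=> /leq_trans; apply; rewrite sum_nat_const leq_mul2r.
by rewrite (card_reserved d_gt0) orbT.
Qed.

(** Off the reserved positions a low block consists of low subblocks; each reserved one contributes
    at most its volume. The bound for high blocks below is symmetric. *)
Lemma block_count_low n : (block_count n.+1 (Some false) <=
  N n ^ d * block_count n (Some false) + #|{: slot d}| * side n ^ d)%N.
Proof.
rewrite block_countS (bigID (fun x => reserved (N n) (box_pt x) : bool))/=.
rewrite addnC leq_add//.
  apply: (@leq_trans (\sum_(x : {ffun 'I_d -> 'I_(N n)})
      block_count n (Some false))%N).
    rewrite big_mkcond leq_sum// => x _; case: ifP => //.
    by rewrite /subtile; case: reserved.
  by rewrite sum_nat_const card_ffun !card_ord.
exact: sum_reserved_le.
Qed.

Lemma block_count_high n : (N n ^ d * block_count n (Some true) <=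
  block_count n.+1 (Some true) + #|{: slot d}| * side n ^ d)%N.
Proof.
have -> : (N n ^ d * block_count n (Some true) =
    \sum_(x : {ffun 'I_d -> 'I_(N n)}) block_count n (Some true))%N.
  by rewrite sum_nat_const card_ffun !card_ord.
rewrite block_countS (bigID (fun x => reserved (N n) (box_pt x) : bool))/=.
rewrite addnC leq_add//.
  rewrite big_mkcond leq_sum// => x _; case: ifP => //.
  by rewrite /subtile; case: reserved.
exact: sum_reserved_le.
Qed.

End Hierarchy.

(** * From colourings to Delone sets *)

Section EuclideanNorm.
Variables (R : realType) (d : nat).
Implicit Types x y : 'rV[R]_d.

Lemma coord_le_enorm x i : `|x ord0 i| <= enorm x.
Proof.
rewrite /enorm -sqrtr_sqr ler_sqrt; last by rewrite sumr_ge0// => j _; exact: sqr_ge0.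
by rewrite (bigD1 i)//= lerDl sumr_ge0// => j _; exact: sqr_ge0.
Qed.

Lemma enorm_le x (a : R) : 0 <= a -> (forall i, `|x ord0 i| <= a) ->
  enorm x <= d%:R * a.
Proof.
move=> a0 xa; have da0 : 0 <= d%:R * a by rewrite mulr_ge0.
rewrite /enorm -[leRHS]ger0_norm// -sqrtr_sqr ler_sqrt ?sqr_ge0//.
apply: (@le_trans _ _ (\sum_(i < d) a ^+ 2)).
  by apply: ler_sum => i _; rewrite -real_normK ?num_real// lerXn2r ?nnegrE.
rewrite sumr_const card_ord -[leLHS]mulr_natl exprMn ler_wpM2r ?sqr_ge0//.
by rewrite expr2 -natrM ler_nat; case: (d) => // m; rewrite leq_pmulr.
Qed.

End EuclideanNorm.

Section PointSet.
Variables (R : realType) (d : nat).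
Hypothesis d_gt0 : (0 < d)%N.

Definition shift_frac (b : bool) : R := if b then 2 / 3 else 1 / 3.

Definition cell_pt (z : 'rV[int]_d) (b : bool) : 'rV[R]_d :=
  \row_i ((z ord0 i)%:~R + shift_frac b).

Definition point_set (w : 'rV[int]_d -> bool) : set 'rV[R]_d :=
  [set x | exists z (b : bool), (b -> w z) /\ x = cell_pt z b].

Lemma shift_frac_itv b : 0 < shift_frac b < 1.
Proof. by rewrite /shift_frac; case: b; lra. Qed.

Lemma cell_ptD v z b : cell_pt (v + z) b = map_mx intr v + cell_pt z b.
Proof. by apply/rowP => i; rewrite !mxE rmorphD/= addrA. Qed.

(* The points lie in (1/3) Z^d. *)
Lemma cell_pt_near z b z' b' :
  (forall i, `|cell_pt z b ord0 i - cell_pt z' b' ord0 i| < 1 / 3) ->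
  cell_pt z b = cell_pt z' b'.
Proof.
move=> near; apply/rowP => i; have := near i; rewrite !mxE.
pose t (b : bool) : int := if b then 2 else 1.
have tE c : shift_frac c = (t c)%:~R / 3 by case: c; rewrite /shift_frac /t; lra.
rewrite !tE; move: (z _ _) (z' _ _) (t b) (t b') => m m' s s'.
have -> : m%:~R + s%:~R / 3 - (m'%:~R + s'%:~R / 3) =
    (m * 3 + s - (m' * 3 + s'))%:~R / 3 :> R.
  by rewrite !(rmorphD, rmorphB, rmorphM)/=; field.
rewrite normrM (ger0_norm (_ : 0 <= 3^-1)) ?invr_ge0// ltr_pM2r ?invr_gt0//.
rewrite -intr_norm -[1]/(1%:~R) ltr_int => E.
have {}E : m * 3 + s = m' * 3 + s' by lia.
have := congr1 (fun x : int => x%:~R : R) E.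
by rewrite !(rmorphD, rmorphM)/=; lra.
Qed.

Lemma point_set_discrete w c : is_subset1 (point_set w `&` eball c (1 / 6)).
Proof.
move=> _ _ [[z [b [_ ->]]] zc] [[z' [b' [_ ->]]] zc'].
apply: cell_pt_near => i.
have := le_lt_trans (coord_le_enorm _ i) zc.
have := le_lt_trans (coord_le_enorm _ i) zc'.
rewrite !mxE !ltr_norml; lra.
Qed.

Lemma delone_point_set w : delone (point_set w).
Proof.
split.
- move=> x Xx; split; first exact: mem_set.
  exists (ball x (1 / 3 : R)); first exact: nbhsx_ballx.
  apply/seteqP; split=> [y [xy Xy]|_ ->]; last by split=> //; exact: ballxx.
  case: Xx Xy xy => z [b [_ ->]] [z' [b' [_ ->]]] xy /=.
  apply: cell_pt_near => i.
  by case: xy => _ /(_ ord0 i); rewrite /ball/= distrC.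
- by exists (1 / 6) => // c; exact: point_set_discrete.
- exists (d%:R + 1); first by rewrite ltr_wpDl.
  (* The first point of the unit cell containing c, present whatever its colour, is at distance at
     most d from c. *)
  move=> c; exists (cell_pt (\row_i Num.floor (c ord0 i)) false); split.
    by exists (\row_i Num.floor (c ord0 i)), false.
  rewrite /eball/=; apply: (@le_lt_trans _ _ (d%:R * 1)); last by rewrite mulr1; lra.
  apply: enorm_le => // i; rewrite !mxE.
  have := Num.Theory.floor_le (c ord0 i); have := floorD1_gt (c ord0 i).
  by rewrite rmorphD/= /shift_frac ler_norml; lra.
Qed.

End PointSet.

(** * Repetition of patches *)

Section Repetitivity.
Variables (R : realType) (d : nat) (N : nat -> nat).
Variable pat : nat -> (tile -> 'rV[int]_d -> bool) -> 'rV[int]_d -> bool.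
Hypothesis d_gt0 : (0 < d)%N.
Hypothesis N_big : forall n, big_enough d (N n).

Local Notation w := (colouring N pat).
Local Notation X := (@point_set R d w).
Local Notation sideN := (side N).

(** In each coordinate the relevant z lie among L consecutive integers starting at floor(x_i - r);
    these meet at most two consecutive intervals of the partition into blocks of side L. *)
Lemma eball_cluster L (r : R) (x : 'rV[R]_d) : 2 * r + 1 <= L%:R ->
  exists k, forall z b, eball x r (cell_pt R z b) ->
    exists e, vdiv L z = k + corner_pt e.
Proof.
move=> rL; pose m : 'rV[int]_d := \row_i Num.floor (x ord0 i - r).
exists (vdiv L m) => z b zx.
exists [ffun i => (z ord0 i %/ L)%Z != (m ord0 i %/ L)%Z].
apply/rowP => i; rewrite !mxE ffunE mxE.
have := le_lt_trans (coord_le_enorm _ i) zx.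
rewrite !mxE ltr_norml => /andP[zx1 zx2].
have := shift_frac_itv R b => /andP[b0 b1].
have m1 := Num.Theory.floor_le (x ord0 i - r).
have m2 := floorD1_gt (x ord0 i - r).
set q := Num.floor _ in m1 m2 *.
have qz : q <= z ord0 i.
  by rewrite -ltzD1 -(ltr_int R) rmorphD/=; lra.
have zq : z ord0 i < q + L%:Z.
  by rewrite -(ltr_int R) rmorphD/= in m2 *; lra.
have L0 : (0 < L)%N by rewrite lt0n; apply/eqP => L0; move: zq; lia.
clear - qz zq L0; move: (z ord0 i) qz zq => y qy yq.
have E1 := divz_eq q L; have E2 := divz_eq y L.
have := ltz_pmod q (_ : 0 < L%:Z); have := ltz_pmod y (_ : 0 < L%:Z).
have := modz_ge0 q (_ : L%:Z != 0); have := modz_ge0 y (_ : L%:Z != 0).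
move: E1 E2; move: (q %/ _)%Z (q %% _)%Z (y %/ _)%Z (y %% _)%Z => a b a' b'.
move=> E1 E2 /(_ ltac:(lia)) ? /(_ ltac:(lia)) ? /(_ ltac:(lia)) ? /(_ ltac:(lia)) ?.
have ? : a <= a' by nia.
have ? : a' <= a + 1 by nia.
by case: eqP => /= ?; lia.
Qed.

Lemma vdiv_eq_near L (z z' : 'rV[int]_d) i : (0 < L)%N -> vdiv L z = vdiv L z' ->
  `|z ord0 i - z' ord0 i| < L%:Z.
Proof.
move=> L0 /rowP/(_ i); rewrite !vdivE => zz'.
rewrite (divz_eq (z ord0 i) L) (divz_eq (z' ord0 i) L) zz'.
have := ltz_pmod (z ord0 i) (_ : 0 < L%:Z).
have := ltz_pmod (z' ord0 i) (_ : 0 < L%:Z).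
have := modz_ge0 (z ord0 i) (_ : L%:Z != 0).
have := modz_ge0 (z' ord0 i) (_ : L%:Z != 0).
move=> /(_ ltac:(lia)) ? /(_ ltac:(lia)) ? /(_ ltac:(lia)) ? /(_ ltac:(lia)) ?.
by rewrite opprD addrACA subrr add0r ltr_norml; lia.
Qed.

(** The patch lies in a cluster of level-n blocks, and a copy of this cluster is displayed in the
    level-(n+1) block containing y. *)
Lemma patch_recur n (r : R) (x y : 'rV[R]_d) : 0 < r -> 2 * r + 1 <= (sideN n)%:R ->
  X x -> exists2 z, patch_translate X x z r &
    Defs.patch X z r `&` eball y ((d%:R + 1) * (sideN n.+1)%:R) !=set0.
Proof.
move=> r0 rL Xx.
have [k kE] := eball_cluster x rL.
pose fy : 'rV[int]_d := \row_i Num.floor (y ord0 i).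
have [p [pE wE]] := colouring_recur pat N_big d_gt0 n k (vdiv (sideN n.+1) fy).
(* Translation by [v] carries the cluster at k to its displayed copy at p. *)
pose v : 'rV[int]_d := (sideN n)%:Z *: (p - k).
have Lgt0 m : (0 < sideN m)%N by exact: side_gt0 N_big m.
have eball0 (z : 'rV[R]_d) s : 0 < s -> eball z s z.
  move=> s0; rewrite /eball/= subrr (le_lt_trans (y := 0))//.
  by rewrite -[leRHS](mulr0 d%:R) enorm_le// => i; rewrite mxE normr0.
have wv z b : eball x r (cell_pt R z b) -> w (v + z) = w z.
  by move=> /kE[e ze]; exact: wE ze.
have zx (z : 'rV[R]_d) : eball (x + map_mx intr v) r z <->
    eball x r (z - map_mx intr v).
  by rewrite /eball/= opprD addrA addrAC.
exists (x + map_mx intr v).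
- split.
  + case: Xx wv => z [b [bz ->]] wv; exists (v + z), b; split.
      by move=> /bz; rewrite (wv z b)//; exact: eball0.
    by rewrite cell_ptD addrC.
  + rewrite addrAC subrr add0r; apply/seteqP; split => [u [Xu]|_ [u [Xu xu] <-]].
      rewrite zx; case: Xu => z [b [bz ->]].
      have -> : cell_pt R z b - map_mx intr v = cell_pt R (z - v) b.
        by rewrite [z - v]addrC cell_ptD (map_mxN intr) addrC.
      move=> xz; exists (cell_pt R (z - v) b).
        split=> //; exists (z - v), b; split=> // /bz.
        by rewrite -(wv _ b xz) addrC subrK.
      by rewrite -cell_ptD addrC subrK.
    split.
      case: Xu xu => z [b [bz ->]] xz; exists (v + z), b; split.
        by rewrite (wv _ b xz).
      by rewrite cell_ptD.
    by rewrite zx addrAC subrr add0r.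
- case: Xx => z [b [bz xE]]; exists (x + map_mx intr v); split.
    split; last exact: eball0.
    exists (v + z), b; split; last by rewrite xE cell_ptD addrC.
    by move=> /bz; rewrite (wv z b)// -xE; exact: eball0.
  have [e ze] : exists e, vdiv (sideN n) z = k + corner_pt e.
    by apply: (kE z b); rewrite -xE; exact: eball0.
  have vz : vdiv (sideN n.+1) (v + z) = vdiv (sideN n.+1) fy.
    by rewrite [LHS]vdivM vdivD// ze subrKA.
  (* The unit cells of both points lie in one level-(n+1) block, so coordinates differ by at most
     its side. The factor d + 1 instead of d makes the bound on the norm strict. *)
  rewrite /eball/= (@le_lt_trans _ _ (d%:R * (sideN n.+1)%:R))//; last first.
    by rewrite ltr_pM2r ?ltr0n// ltrDl.
  apply: enorm_le => // i.
  have := vdiv_eq_near i (Lgt0 n.+1) vz.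
  have -> : x + map_mx intr v - y = cell_pt R (v + z) b - y.
    by congr (_ - _); rewrite xE cell_ptD addrC.
  rewrite !mxE.
  have := shift_frac_itv R b => /andP[b0 b1].
  have m1 := Num.Theory.floor_le (y ord0 i).
  have m2 := floorD1_gt (y ord0 i).
  move: m1 m2; rewrite ler_norml ltr_norml.
  move: (_ + z ord0 i) (Num.floor _) => D t m1 m2 DL.
  have {DL} [D1 D2] : t - (sideN n.+1)%:Z + 1 <= D /\ D <= t + (sideN n.+1)%:Z - 1.
    by move: DL; lia.
  move: D1 D2 m2; rewrite -!(ler_int R) !(rmorphD, rmorphN)/= => D1 D2 m2.
  pose l : R := (sideN n.+1)%:R.
  have {}D1 : t%:~R - l + 1 <= D%:~R by exact: D1.
  have {}D2 : D%:~R <= t%:~R + l - 1 by exact: D2.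
  have {}m2 : y ord0 i < t%:~R + 1 by exact: m2.
  rewrite -[(N n * _)%:R]/l; lra.
Qed.

End Repetitivity.

(** * Growth of the scales *)

Section Scales.
Variable R : realType.

(** From ln(1 + t) <= t at t = -2/3, that is, ln(1/3) <= -2/3. *)
Lemma ln_ge_two_thirds (x : R) : 3 <= x -> 2 / 3 <= ln x.
Proof.
move=> x3; apply: (@le_trans _ _ (ln 3)); last by rewrite ler_ln ?posrE//; lra.
rewrite -[X in ln X]invrK lnV ?posrE ?invr_gt0// lerNr.
apply: le_trans (le_ln1Dx (x := - (2 / 3)) _); last by lra.
by rewrite ler_ln ?posrE ?invr_gt0//; lra.
Qed.

(** n (ln n)^2, shifted so that the telescoping sum of its inverses starts at ln 3, away from the
    zero of the logarithm. *)
Definition weight (n : nat) : R := n.+4%:R * ln n.+4%:R ^+ 2.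

Lemma weight_ge n : n.+4%:R * (4 / 9) <= weight n.
Proof.
have l3 : 2 / 3 <= ln n.+4%:R :> R by rewrite ln_ge_two_thirds// ler_nat.
by rewrite /weight ler_pM2l ?ltr0n//; nra.
Qed.

Lemma weight_gt0 n : 0 < weight n.
Proof. by apply: lt_le_trans (weight_ge n); rewrite mulr_gt0 ?ltr0n//; lra. Qed.

(* [1 / (x ln(x)^2) <= 1 / ln(x - 1) - 1 / ln x], so the sum telescopes. *)
Lemma sum_weight_le n : \sum_(i < n) (weight i)^-1 <= 3 / 2.
Proof.
suff : \sum_(i < n) (weight i)^-1 <= (ln 3)^-1 - (ln n.+3%:R)^-1.
  move=> /le_trans; apply; have l3 : 2 / 3 <= ln n.+3%:R :> R.
    by rewrite ln_ge_two_thirds// ler_nat.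
  rewrite lerBlDr (@le_trans _ _ (3 / 2))//; last by rewrite lerDl invr_ge0; lra.
  have l3' := ln_ge_two_thirds (lexx 3).
  by rewrite invf_ple ?posrE; lra.
elim: n => [|n IH]; first by rewrite big_ord0 subrr.
rewrite big_ord_recr/=.
suff : (weight n)^-1 <= (ln n.+3%:R)^-1 - (ln n.+4%:R)^-1 by move: IH; lra.
have a0 : 2 / 3 <= ln n.+3%:R :> R by rewrite ln_ge_two_thirds// ler_nat.
(* ln(1 - t) <= -t with t = 1/(n+4) separates consecutive logarithms by at least 1/(n+4). *)
have ab : ln n.+3%:R <= ln n.+4%:R - n.+4%:R^-1 :> R.
  have -> : n.+3%:R = n.+4%:R * (1 - n.+4%:R^-1) :> R.
    by rewrite mulrBr mulr1 mulfV ?pnatr_eq0// -[in RHS]addn1 natrD addrK.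
  have n1 : n.+4%:R^-1 < 1 :> R by rewrite invf_lt1 ?ltr1n.
  rewrite lnM ?posrE ?subr_gt0// lerD2l; apply: le_ln1Dx.
  by rewrite ltrN2.
have m0 : 0 < n.+4%:R^-1 :> R by rewrite invr_gt0.
rewrite /weight invfM; move: ab a0 m0.
move: (n.+4%:R^-1) (ln n.+3%:R) (ln n.+4%:R) => m a b ab a0 m0.
have -> : a^-1 - b^-1 = (b - a) * (a * b)^-1 by field; apply/andP; split; lra.
apply: (@le_trans _ _ (m * (a * b)^-1)).
  by rewrite ler_pM2l// expr2 lef_pV2 ?posrE ?mulr_gt0 ?ler_pM2r; lra.
by rewrite ler_pM2r ?invr_gt0 ?mulr_gt0; lra.
Qed.

(** Take the least h with v <= h^k. If h >= 2, then (h-1)^k < v and h <= 2(h-1). *)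
Lemma even_root_exists (k : nat) (v : R) : (0 < k)%N -> 1 <= v ->
  exists h : nat, v <= h%:R ^+ k /\ h%:R ^+ k <= 2 ^+ k * v.
Proof.
move=> k0 v1.
have ex : exists h : nat, v <= h%:R ^+ k.
  exists (Num.truncn v).+1; apply: le_trans (ltW (Num.Theory.truncnS_gt v)) _.
  by rewrite ler_eXnr// ?ler1n.
have [h vh hmin] := ex_minnP ex; exists h; split=> //.
case: h vh hmin => [|[|h]] vh hmin.
- by rewrite expr0n gtn_eqF//= mulr_ge0 ?exprn_ge0//; lra.
- by rewrite expr1n -[leLHS]mul1r ler_pM// exprn_ege1// ler1n.
- have hv : h.+1%:R ^+ k < v.
    by rewrite ltNge; apply/negP => /hmin; rewrite ltnn.
  rewrite (@le_trans _ _ (2 ^+ k * h.+1%:R ^+ k))//.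
    by rewrite -exprMn lerXn2r ?nnegrE ?mulr_ge0// -natrM ler_nat; lia.
  by rewrite ler_pM2l ?exprn_gt0// ltW.
Qed.

End Scales.

(** * Growth of the repetitivity function *)

Section Growth.
Variable R : realType.

(** Inverts y ~ m ln m. If y >= m^2, then ln y <= 2 sqrt(y) gives y / ln y >= m / 2; otherwise ln y
    <= 2 ln m. *)
Lemma div_ln_ge (a m y : R) : 0 < a <= 1 -> 1 < m -> 1 < y ->
  a * (m * ln m) <= y -> a / 2 * m <= y / ln y.
Proof.
move=> /andP[a0 a1] m1 y1 amy; have lny0 := ln_gt0 y1; have lnm0 := ln_gt0 m1.
have [my|ym] := leP (m ^+ 2) y.
  pose s := Num.sqrt y; have s2 : s ^+ 2 = y by rewrite sqr_sqrtr//; lra.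
  have s0 : 0 < s by rewrite sqrtr_gt0; lra.
  have ms : m <= s by rewrite -(ler_pXn2r (n := 2)) ?nnegrE ?s2//; lra.
  have lns : ln y <= 2 * s.
    by rewrite -s2 lnXn// -[leLHS]mulr_natl ler_pM2l// ltW// ln_sublinear.
  apply: (@le_trans _ _ (s / 2)); first by nra.
  by rewrite ler_pdivlMr//; nra.
have lnym : ln y <= 2 * ln m.
  have -> : 2 * ln m = ln (m ^+ 2) by rewrite lnXn ?mulr_natl//; lra.
  by rewrite ler_ln ?posrE ?exprn_gt0 ?(ltW ym)//; lra.
by rewrite ler_pdivlMr//; nra.
Qed.

(** The lower half of Stirling's estimate, by induction from ln(m+1) <= ln m + 1/m. *)
Lemma ln_fact_ge m : m%:R * ln m%:R - m%:R <= ln (m`!)%:R :> R.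
Proof.
elim: m => [|m IH]; first by rewrite mul0r subr0 fact0 ln1.
have [->|m0] := posnP m; first by rewrite factS fact0 muln1 ln1 mulr0; lra.
rewrite factS natrM lnM ?posrE ?ltr0n ?fact_gt0//.
have m0' : 0 < m%:R :> R by rewrite ltr0n.
have : ln m.+1%:R <= ln m%:R + m%:R^-1 :> R.
  have -> : m.+1%:R = m%:R * (1 + m%:R^-1) :> R.
    by rewrite mulrDr mulr1 mulfV ?gt_eqF// -natr1.
  rewrite lnM ?posrE ?addr_gt0 ?invr_gt0// lerD2l le_ln1Dx//.
  by rewrite (lt_trans (y := 0)) ?invr_gt0//; lra.
move=> /(ler_wpM2l (ltW m0')); rewrite mulrDr mulfV ?gt_eqF//.
by rewrite -[m.+1]addn1 natrD; lra.
Qed.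

Lemma ln_le_powR (x e : R) : 0 < x -> 0 < e -> ln x <= x `^ e / e.
Proof.
move=> x0 e0; rewrite ler_pdivlMr// mulrC -ln_powR ltW// ln_sublinear//.
exact: powR_gt0.
Qed.

Lemma expr_root (x : R) n : (0 < n)%N -> 0 <= x -> x = (x ^+ n) `^ (n%:R^-1).
Proof.
move=> n0 x0; rewrite -powR_mulrn// -powRrM mulfV ?powRr1//.
by rewrite pnatr_eq0 -lt0n.
Qed.

Variables (d : nat) (N : nat -> nat) (C : R) (lev : R -> nat).
Hypothesis d_gt0 : (0 < d)%N.
Hypothesis N_gt : forall n, (n < N n ^ d)%N.
Hypothesis N_le : forall n, (N n)%:R ^+ d <= C * weight R n.
Hypothesis lev_ge : forall r, 2 * r + 1 <= (side N (lev r))%:R.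
Hypothesis lev_min : forall r n, 2 * r + 1 <= (side N n)%:R -> (lev r <= n)%N.

Let d0 : 0 < d%:R :> R. Proof. by rewrite ltr0n. Qed.

Let side_fact m : (m`! <= side N m ^ d)%N.
Proof.
elim: m => [|m IH]; first by rewrite exp1n.
by rewrite factS /= expnMn leq_mul.
Qed.

Lemma side_pos m : (0 < side N m)%N.
Proof.
by have := leq_trans (fact_gt0 m) (side_fact m); rewrite expn_gt0 (gtn_eqF d_gt0) orbF.
Qed.

Lemma lev_infty M : \forall r \near +oo, (M < lev r)%N.
Proof.
exists (side N M)%:R; split; first exact: num_real.
move=> r Mr; rewrite ltnNge; apply/negP => rM.
have := lev_ge r; apply/negP; rewrite -ltNge.
suff : (side N (lev r))%:R <= (side N M)%:R :> R.
  by have : 0 <= (side N M)%:R :> R := ler0n _ _; lra.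
rewrite ler_nat; move: rM; elim: {Mr} M => [|M IH]; first by rewrite leqn0 => /eqP ->.
rewrite leq_eqVlt => /predU1P[->//|]; rewrite ltnS => /IH /leq_trans; apply.
rewrite /= leq_pmull//; have := N_gt M; case: (N M) => //.
by rewrite exp0n.
Qed.

Lemma side_lt r m : lev r = m.+1 -> 1 <= r -> (side N m)%:R < 3 * r.
Proof.
move=> rm r1; rewrite ltNge; apply/negP => H.
have : (lev r <= m)%N by apply: lev_min; lra.
by rewrite rm ltnn.
Qed.

(** With [lev r] = m + 1, minimality of the level gives m! <= ([side m])^d < (3r)^d. Stirling turns
    this into m ln m <= 2d ln r, and [div_ln_ge] solves for m. *)
Lemma ln_side_ge : \forall r \near +oo,
  (d%:R * 4)^-1 * (lev r).-1%:R <= ln r / ln (ln r).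
Proof.
(* For m >= 2d and ln m >= 4 the error m + d ln 3 <= 2m is at most half of m ln m. *)
pose T := Num.truncn (expR 4 : R); pose M := (2 * d + T).+1%N.
near=> r.
have r1 : 1 <= r by near: r; exact: nbhs_pinfty_ge.
have : (M.+1 < lev r)%N by near: r; exact: lev_infty.
case E : (lev r) => [//|m]; rewrite ltnS /= => Mm.
have := side_lt E r1; set s := (_%:R) => sr.
have s0 : 0 < s by rewrite /s ltr0n side_pos.
have dm : 2 * d%:R <= m%:R :> R by rewrite -natrM ler_nat; rewrite /M in Mm; lia.
have m0 : 0 < m%:R :> R by rewrite ltr0n; rewrite /M in Mm; lia.
have lnm : 4 <= ln m%:R :> R.
  rewrite -ler_expR lnK ?posrE// (@le_trans _ _ T.+1%:R)//.
    exact/ltW/Num.Theory.truncnS_gt.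
  by rewrite ler_nat; rewrite /M in Mm; lia.
have ln3 : ln 3 <= 2 :> R.
  have -> : 3 = 1 + 2 :> R by lra.
  by apply: le_ln1Dx; lra.
have lnr : ln s - ln 3 <= ln r.
  have r0 : 0 < r by lra.
  by rewrite lerBlDl -lnM ?posrE// ler_ln ?posrE ?(ltW sr) ?mulr_gt0.
have lns : m%:R * ln m%:R - m%:R <= d%:R * ln s.
  apply: le_trans (ln_fact_ge m) _.
  have -> : d%:R * ln s = ln (s ^+ d) by rewrite lnXn ?mulr_natl.
  rewrite ler_ln ?posrE ?exprn_gt0 ?ltr0n ?fact_gt0 ?side_pos//.
  by rewrite -[s ^+ d]natrX ler_nat side_fact.
have key : d%:R * 2 * ln r >= m%:R * ln m%:R.
  have : d%:R * ln r >= d%:R * ln s - d%:R * ln 3.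
    by rewrite -mulrBr ler_pM2l.
  have : d%:R * ln 3 <= d%:R * 2 :> R by rewrite ler_pM2l.
  have : m%:R * 4 <= m%:R * ln m%:R :> R by rewrite ler_pM2l.
  by lra.
have d1 : 1 <= d%:R :> R by rewrite ler1n.
rewrite [leLHS](_ : _ = ((d%:R * 2)^-1 / 2) * m%:R); last by field; lra.
apply: div_ln_ge.
- by rewrite invr_gt0 invf_le1; lra.
- by lra.
- have : m%:R * 4 <= m%:R * ln m%:R :> R by rewrite ler_pM2l.
  nra.
- by rewrite mulrC ler_pdivrMr 1?mulrC //; lra.
Unshelve. all: by end_near. Qed.

(** With e = td/2, each of the two logarithms in the weight costs a factor x^e / e, and the d-th
    root of x^(1 + 2e) is x^(1/d + t). *)
Lemma branch_le_powR t : 0 < t -> exists2 K : R, 0 < K &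
  forall k (x : R), k.+4%:R <= x -> (N k)%:R <= K * x `^ (d%:R^-1 + t).
Proof.
move=> t0; pose e := t * d%:R / 2; have e0 : 0 < e by rewrite divr_gt0 ?mulr_gt0.
have C0 : 0 < C.
  rewrite -(pmulr_lgt0 _ (weight_gt0 R 0)); apply: lt_le_trans (N_le 0).
  by rewrite exprn_gt0// ltr0n; have := N_gt 0; case: (N 0) => //; rewrite exp0n.
exists ((C / e ^+ 2) `^ d%:R^-1); first by rewrite powR_gt0 ?divr_gt0 ?exprn_gt0.
move=> k x kx; have x0 : 0 < x by apply: lt_le_trans kx; rewrite ltr0n.
have k1 : 0 <= ln k.+4%:R :> R by rewrite ln_ge0// ler1n.
rewrite [leLHS](expr_root d_gt0)//.
rewrite (_ : d%:R^-1 + t = (1 + e + e) * d%:R^-1); last first.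
  by rewrite /e; field; exact: lt0r_neq0.
rewrite powRrM -powRM ?powR_ge0 ?divr_ge0 ?sqr_ge0 ?(ltW C0)//.
apply: ge0_ler_powR; rewrite ?nnegrE ?invr_ge0 ?exprn_ge0 ?mulr_ge0 ?powR_ge0
  ?sqr_ge0 ?(ltW C0)//.
  by rewrite invr_ge0 sqr_ge0.
apply: (le_trans (N_le k)).
rewrite -mulrA ler_pM2l// !powRD ?(gt_eqF x0) ?implybT// powRr1 ?(ltW x0)//.
have -> : (e ^+ 2)^-1 * (x * x `^ e * x `^ e) = x * (x `^ e / e) ^+ 2.
  by field; exact: lt0r_neq0.
rewrite /weight ler_pM ?sqr_ge0// lerXn2r ?nnegrE ?divr_ge0 ?powR_ge0 ?mulr_ge0
  ?(ltW t0)//.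
apply: (@le_trans _ _ (ln x)); last exact: ln_le_powR.
by rewrite ler_ln ?posrE.
Qed.

(** Let [lev r] = m + 1, x = m + 5 and s = q - 2/d. The side at level m + 2 is N_(m+1) N_m times
    that at level m, which is below 3r; the two branching numbers contribute x^(2/d + s/2), and the
    denominator is at least of order r x^q. The quotient is thus at most [K2] x^(-s/2). *)
Lemma growth_cvg (q : R) : 2 / d%:R < q ->
  (d%:R + 1) * (side N (lev r).+1)%:R / (r * (ln r / ln (ln r)) `^ q)
    @[r --> +oo] --> (0 : R).
Proof.
move=> dq; pose s := q - 2 / d%:R; have s0 : 0 < s by rewrite subr_gt0.
have q0 : 0 < q by apply: lt_trans dq; rewrite divr_gt0.
have [K K0 KN] : exists2 K : R, 0 < K & forall k (x : R), k.+4%:R <= x ->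
    (N k)%:R <= K * x `^ (d%:R^-1 + s / 4).
  by apply: branch_le_powR; rewrite divr_gt0.
(* The factor from [ln_side_ge], divided by 6 because x = m + 5 <= 6m. *)
pose c : R := (d%:R * 4)^-1 / 6.
have c0 : 0 < c by rewrite divr_gt0 ?invr_gt0 ?mulr_gt0.
pose K2 := (d%:R + 1) * 3 * K ^+ 2 / c `^ q.
have K20 : 0 < K2.
  by rewrite divr_gt0 ?mulr_gt0 ?exprn_gt0 ?powR_gt0// ltr_wpDl.
apply/cvgrPdist_lt => e e0.
have [M KM] : exists M : nat, (K2 / e) `^ (s / 2)^-1 < M%:R.
  by exists (Num.truncn ((K2 / e) `^ (s / 2)^-1)).+1; exact: Num.Theory.truncnS_gt.
near=> r.
have r1 : 1 <= r by near: r; exact: nbhs_pinfty_ge.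
have : (M.+1 < lev r)%N by near: r; exact: lev_infty.
have : (d%:R * 4)^-1 * (lev r).-1%:R <= ln r / ln (ln r).
  by near: r; exact: ln_side_ge.
case E : (lev r) => [//|m] /=; set g := ln r / ln (ln r); rewrite ltnS => mg Mm.
have sm := side_lt E r1.
pose x : R := m.+1.+4%:R.
have x0 : 0 < x by rewrite ltr0n.
have Nm : (N m)%:R <= K * x `^ (d%:R^-1 + s / 4) by apply: KN; rewrite ler_nat.
have Nm1 : (N m.+1)%:R <= K * x `^ (d%:R^-1 + s / 4) by apply: KN.
have cx : c * x <= g.
  apply: le_trans mg; rewrite /c -mulrA ler_pM2l ?invr_gt0 ?mulr_gt0//.
  have m1 : 1 <= m%:R :> R by rewrite ler1n (leq_ltn_trans _ Mm).
  have -> : x = m%:R + 5 by rewrite -natrD addnC.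
  by lra.
have cxq : c `^ q * x `^ q <= g `^ q.
  rewrite -powRM ?(ltW c0) ?(ltW x0)//; apply: ge0_ler_powR => //.
  - exact: ltW.
  - by rewrite nnegrE mulr_ge0 ?(ltW c0) ?(ltW x0).
  - by rewrite nnegrE (le_trans _ cx)// mulr_ge0 ?(ltW c0) ?(ltW x0).
have gq0 : 0 < g `^ q by apply: lt_le_trans cxq; rewrite mulr_gt0 ?powR_gt0.
have r0 : 0 < r by lra.
have bound : (d%:R + 1) * (side N m.+2)%:R / (r * g `^ q) <= K2 * x `^ (- (s / 2)).
  have -> : K2 * x `^ (- (s / 2)) = (d%:R + 1) * 3 * (K * x `^ (d%:R^-1 + s / 4)) ^+ 2
      / (c `^ q * x `^ q).
    have -> : - (s / 2) = d%:R^-1 + s / 4 + (d%:R^-1 + s / 4) - q.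
      by rewrite /s; lra.
    rewrite powRB ?(gt_eqF x0) ?implybT//.
    rewrite [x `^ (_ + _ + (_ + _))]powRD ?(gt_eqF x0) ?implybT//.
    rewrite /K2; field.
    by rewrite !gt_eqF ?powR_gt0.
  set X := K * _ in Nm Nm1 *; rewrite ler_pdivrMr ?mulr_gt0//.
  rewrite [leRHS]mulrAC ler_pdivlMr ?mulr_gt0 ?powR_gt0//.
  rewrite (_ : (_ + 1) * 3 * X ^+ 2 * _ =
    (d%:R + 1) * (X ^+ 2 * (3 * r) * g `^ q)); last by ring.
  rewrite -[leLHS]mulrA ler_pM2l ?ltr_wpDl//.
  rewrite /= !natrM mulrA; set y := (side N m)%:R in sm *.
  have y0 : 0 <= y by exact: ler0n.
  have NN : (N m.+1)%:R * (N m)%:R <= X ^+ 2 by rewrite expr2 ler_pM.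
  apply: ler_pM => //.
  - by rewrite !mulr_ge0.
  - by rewrite mulr_ge0 ?powR_ge0.
  - by apply: ler_pM; [exact: mulr_ge0|exact: y0|exact: NN|exact: ltW sm].
have K2x : K2 * x `^ (- (s / 2)) < e.
  rewrite powRN ltr_pdivrMr ?powR_gt0// mulrC -ltr_pdivrMr//.
  have Ke0 : 0 <= K2 / e by rewrite divr_ge0 ?(ltW K20) ?(ltW e0).
  have -> : K2 / e = ((K2 / e) `^ (s / 2)^-1) `^ (s / 2).
    by rewrite -powRrM mulVf ?powRr1// gt_eqF ?divr_gt0.
  apply: gt0_ltr_powR; rewrite ?nnegrE ?divr_gt0 ?powR_ge0 ?(ltW x0)//.
  apply: (lt_le_trans KM); rewrite /x ler_nat.
  by rewrite (leq_trans (ltnW Mm))// !leqW.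
rewrite sub0r normrN ger0_norm; first exact: le_lt_trans bound K2x.
by rewrite divr_ge0 ?mulr_ge0 ?(ltW gq0) ?(ltW r0)// addr_ge0.
Unshelve. all: by end_near. Qed.

End Growth.

(** * Cells of the unit cube *)

Section Boxes.
Variable R : realType.

Definition rbox d (I : 'I_d -> interval R) : set 'rV[R]_d :=
  [set x | forall i, x ord0 i \in I i].

Lemma measurable_rbox d (I : 'I_d -> interval R) : measurable (rbox I).
Proof.
have -> : rbox I = \bigcap_(i in [set: 'I_d]) (@rV_coord R d i @^-1` [set` I i]).
  by apply/seteqP; split=> x xI i; [move=> _|]; exact: xI.
apply: fin_bigcap_measurable => // i _.
rewrite -[X in measurable X]setTI.
exact: measurable_rV_coord.
Qed.

Lemma borel_lebesgue_rbox d (I : 'I_d -> interval R) (c : R) :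
  (forall i, lebesgue_measure ([set` I i] : set R) = c%:E) ->
  borel_lebesgue_rV R d (rbox I) = (c ^+ d)%:E.
Proof.
elim: d I => [|d IH] I Ic.
  by rewrite /= diracE mem_set// => -[].
rewrite /= /rV_cons_measure /pushforward.
have -> : @rV_cons R d @^-1` rbox I =
    [set` I ord0] `*` rbox (fun i => I (lift ord0 i)).
  have e0 a (y : 'rV[R]_d) : rV_cons (a, y) ord0 ord0 = a.
    rewrite /rV_cons [LHS](_ : _ = row_mx (const_mx a : 'rV_1) y ord0 (lshift d ord0)).
      by rewrite row_mxEl mxE.
    by congr (row_mx _ _ _ _); exact/val_inj.
  have eS a (y : 'rV[R]_d) i : rV_cons (a, y) ord0 (lift ord0 i) = y ord0 i.
    rewrite /rV_cons [LHS](_ : _ = row_mx (const_mx a : 'rV_1) y ord0 (rshift 1 i)).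
      by rewrite row_mxEr.
    by congr (row_mx _ _ _ _); exact/val_inj.
  apply/seteqP; split=> [[a y] /= ayI|[a y] /= [aI yI] i].
    by split=> [|i]; [rewrite -(e0 a y)|rewrite -(eS a y)]; exact: ayI.
  by case: (unliftP ord0 i) => [j|] ->; rewrite ?eS ?e0//; exact: yI.
rewrite product_measure1E//; last exact: measurable_rbox.
transitivity (c%:E * (c ^+ d)%:E)%E; last by rewrite -EFinM exprS.
by congr (_ * _)%E; [exact: Ic|exact: IH].
Qed.

Lemma lebesgueType_measurable d (A : set 'rV[R]_d) :
  measurable A -> measurable (A : set (lebesgueType R d)).
Proof. exact: caratheodory_measurable_mu_ext. Qed.

Lemma lebesgue_borelE d (A : set 'rV[R]_d) :
  measurable A -> lebesgue R d A = borel_lebesgue_rV R d A.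
Proof. exact: measurable_mu_extE. Qed.

End Boxes.

Section Cells.
Variables (R : realType) (d h : nat).
Hypothesis h_gt0 : (0 < h)%N.
Implicit Types (j : {ffun 'I_d -> 'I_h}) (x : 'rV[R]_d).

Let h0 : 0 < h%:R :> R. Proof. by rewrite ltr0n. Qed.

(* The cells partition the closed cube: the last interval in each direction is
   closed on the right. *)
Definition cell_itv (k : nat) : interval R :=
  Interval (BLeft (k%:R / h%:R)) (BSide (k.+1 != h) (k.+1%:R / h%:R)).

Definition cell j : set 'rV[R]_d := rbox (fun i => cell_itv (j i)).

Lemma cell_itv_near k (t : R) : t \in cell_itv k -> 0 <= t - k%:R / h%:R <= h%:R^-1.
Proof.
rewrite /cell_itv in_itv/= => /andP[kt tk].
rewrite subr_ge0 kt/= lerBlDl -[X in _ + X]mul1r -mulrDl natr1.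
by move: tk; case: (_ != _) => //= /ltW.
Qed.

Lemma cell_itv_cover (t : R) : 0 <= t <= 1 -> exists k : 'I_h, t \in cell_itv k.
Proof.
move=> /andP[t0 t1]; have th0 : 0 <= t * h%:R by rewrite mulr_ge0.
have /andP[n1 n2] := Num.Theory.truncn_itv th0.
have [nh|hn] := ltnP (Num.truncn (t * h%:R)) h.
  exists (Ordinal nh); rewrite /cell_itv in_itv/= ler_pdivrMr// n1/=.
  by case: (_ != _); rewrite /= ?ltr_pdivlMr// ?ler_pdivlMr// ltW.
(* Only t = 1 remains; it belongs to the last interval, closed on the right. *)
have hp : (h.-1 < h)%N by rewrite ltn_predL.
exists (Ordinal hp); rewrite /cell_itv in_itv/= prednK// eqxx/=.
rewrite divff ?gt_eqF// t1 andbT.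
rewrite ler_pdivrMr// (le_trans _ n1)// ler_nat; exact: leq_trans (leq_pred _) hn.
Qed.

Lemma cell_itv_inj (k k' : 'I_h) (t : R) :
  t \in cell_itv k -> t \in cell_itv k' -> k = k'.
Proof.
have aux (l l' : 'I_h) : t \in cell_itv l -> t \in cell_itv l' -> ~ (l < l')%N.
  rewrite /cell_itv !in_itv/= => /andP[_ tl] /andP[l't _] ll'.
  have lh : l.+1 != h by rewrite neq_ltn (leq_ltn_trans ll').
  move: tl; rewrite lh/= ltNge => /negP; apply; apply: le_trans l't.
  by rewrite ler_pM2r ?invr_gt0// ler_nat.
move=> tk tk'; apply/val_inj.
by case: (ltngtP k k') => // [/(aux _ _ tk tk')|/(aux _ _ tk' tk)].
Qed.

Lemma cell_cover x : cube d 1 x -> exists j, cell j x.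
Proof.
move=> x01; have [k kE] := choice (fun i => cell_itv_cover (x01 i)).
by exists [ffun i => k i] => i /=; rewrite ffunE.
Qed.

Lemma cell_sub j : cell j `<=` cube d 1.
Proof.
move=> x xj i; have := xj i; rewrite /cell_itv in_itv/= => /andP[x1 x2].
rewrite (le_trans _ x1) ?divr_ge0//=.
apply: (@le_trans _ _ ((j i).+1%:R / h%:R)).
  by move: x2; case: (_ != _) => //= /ltW.
by rewrite ler_pdivrMr// mul1r ler_nat.
Qed.

Lemma cell_inj j j' x : cell j x -> cell j' x -> j = j'.
Proof.
move=> xj xj'; apply/ffunP => i.
by apply: (@cell_itv_inj _ _ (x ord0 i)); [exact: xj|exact: xj'].
Qed.

Lemma measurable_cell j : measurable (cell j : set (lebesgueType R d)).
Proof. apply: lebesgueType_measurable; exact: measurable_rbox. Qed.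

Lemma lebesgue_cell j : lebesgue R d (cell j) = (h%:R ^- d)%:E.
Proof.
rewrite lebesgue_borelE; last exact: measurable_rbox.
rewrite -exprVn; apply: borel_lebesgue_rbox => i.
rewrite lebesgue_measure_itv/= lte_fin ltr_pM2r ?invr_gt0// ltr_nat ltnSn.
by rewrite -EFinB -mulrBl -natr1 addrAC subrr add0r mul1r.
Qed.

Definition cell_corner j : 'rV[R]_d := \row_i ((j i)%:R / h%:R).

Lemma cell_near j x i : cell j x ->
  0 <= x ord0 i - cell_corner j ord0 i <= h%:R^-1.
Proof. by move=> /(_ i)/cell_itv_near; rewrite mxE. Qed.

Lemma cell_corner_in j : cell j (cell_corner j).
Proof.
move=> i; rewrite /cell_itv in_itv/= mxE lexx/=.
by case: (_ != _) => /=; rewrite ?ltr_pM2r ?ler_pM2r ?invr_gt0// ?ltr_nat ?ler_nat.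
Qed.

Lemma cube_cells : cube d 1 = \big[setU/set0]_(j <- enum {ffun 'I_d -> 'I_h}) cell j.
Proof.
rewrite -bigcup_seq; apply/seteqP; split=> [x /cell_cover[j xj]|x [j _]].
  by exists j => //=; rewrite mem_enum.
exact: cell_sub.
Qed.

Lemma trivIset_cell (D : set {ffun 'I_d -> 'I_h}) : trivIset D cell.
Proof. by move=> j j' _ _ [x [xj xj']]; exact: cell_inj xj xj'. Qed.

End Cells.

(** * Continuous functions on the unit cube *)

Section CubeContinuity.
Variables (R : realType) (d : nat).

Lemma measurable_cube : measurable (cube d 1 : set (lebesgueType R d)).
Proof.
have -> : cube d 1 = rbox (fun=> `[0%R, 1%R]) :> set 'rV[R]_d.
  by apply/seteqP; split=> x xi i; have := xi i; rewrite /= in_itv.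
apply: lebesgueType_measurable; exact: measurable_rbox.
Qed.

Lemma cube_compact : compact (cube d 1 : set 'rV[R]_d).
Proof.
have -> : cube d 1 =
    [set v : 'rV[R]_d | forall i : 'I_d, `[0%R, 1%R]%classic (v ord0 i)].
  by apply/seteqP; split=> x xi i; have := xi i; rewrite /= in_itv.
by apply: (@rV_compact R d (fun=> `[0%R, 1%R]%classic)) => i; exact: segment_compact.
Qed.

(** The Heine-Cantor theorem, using compactness as a near-covering property along the filter of
    small positive [del]. *)
Lemma cube_unif_continuous (f : 'rV[R]_d -> R) (e : R) :
  {within cube d 1, continuous f} -> 0 < e -> exists2 del : R, 0 < del &
    forall x y, cube d 1 x -> cube d 1 y -> ball x del y -> `|f x - f y| < e.
Proof.
move=> /subspace_continuousP cf e0.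
pose P (del : R) (x : 'rV[R]_d) := cube d 1 x -> 
  forall y, cube d 1 y -> ball x del y -> `|f x - f y| < e.
have : \forall del \near 0^'+, cube d 1 `<=` P del.
  move/compact_near_coveringP : cube_compact; apply => x x01.
  have /cvgrPdist_lt/(_ (e / 2)) := cf x x01.
  rewrite divr_gt0// => /(_ isT); rewrite near_withinE => /nbhs_ballP[r /= r0 rP].
  exists (ball x (r / 2), [set del | 0 < del < r / 2]) => /=.
    split; first exact: nbhsx_ballx (divr_gt0 r0 _).
    by near=> del; apply/andP; split; near: del; [exact: nbhs_right_gt|
      apply: nbhs_right_lt; exact: divr_gt0].
  move=> [y del] /= [xy /andP[_ delr]] y01 z z01 yz.
  have xz : ball x r z.
    by rewrite [r]splitr; apply: ball_triangle xy _; apply: le_ball yz; exact: ltW.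
  have {}xy : ball x r y by apply: le_ball xy; lra.
  have := rP _ xy y01; have := rP _ xz z01 => /=.
  by rewrite /from_subspace !ltr_norml; lra.
move=> H; have : \forall del \near 0^'+, 0 < del /\ cube d 1 `<=` P del.
  by near=> del; split; [near: del; exact: nbhs_right_gt|near: del].
move=> /(@filter_ex _ _ _) [del [del0 delP]]; exists del => // x y x01.
exact: delP.
Unshelve. all: by end_near. Qed.

Lemma cell_ball h (j : {ffun 'I_d -> 'I_h.+1}) (del : R) x :
  h.+1%:R^-1 < del -> cell j x -> ball (cell_corner R j) del x.
Proof.
move=> hdel xj; split; first exact: le_lt_trans hdel.
by move=> i k; rewrite (ord1 i) /ball/= distrC ger0_norm;
  have /andP[a b] := cell_near k xj => //; exact: le_lt_trans hdel.
Qed.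

(** By uniform continuity f is the pointwise limit of the step functions that take on each cell the
    value of f at its corner. *)
Lemma cube_continuous_measurable (f : 'rV[R]_d -> R) :
  {within cube d 1, continuous f} ->
  measurable_fun (cube d 1 : set (lebesgueType R d)) f.
Proof.
move=> cf.
pose g h (x : lebesgueType R d) : R := \sum_(j : {ffun 'I_d -> 'I_h.+1})
  f (cell_corner R j) * \1_(cell j) x.
apply: (@measurable_fun_cvg _ _ _ _ g).
  move=> h; apply: measurable_sum => j.
  apply: measurable_funM; first exact: measurable_cst.
  apply: measurable_funTS; apply: measurable_indic; exact: measurable_cell.
move=> x x01; apply/cvgrPdist_lt => e e0.
have [del del0 delP] := cube_unif_continuous cf e0.
near=> h.
have [j xj] := cell_cover (ltn0Sn h) x01.
have -> : g h x = f (cell_corner R j).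
  rewrite /g (bigD1 j)//= indicE mem_set// mulr1 big1 ?addr0// => k kj.
  rewrite indicE memNset ?mulr0// => xk.
  by move/eqP : kj; apply; exact: cell_inj xk xj.
rewrite distrC; apply: delP => //.
  by apply: (cell_sub (ltn0Sn h)); exact: cell_corner_in.
apply: cell_ball xj; near: h.
exact: near_infty_natSinv_lt (PosNum del0).
Unshelve. all: by end_near. Qed.

End CubeContinuity.

(** * Integrals and partitions *)

Section Partition.
Context dsp (T : measurableType dsp) (R : realType).
Variable mu : {measure set T -> \bar R}.

Lemma integral_near_cst (A : set T) (f : T -> R) (c e m : R) :
  measurable A -> mu A = m%:E -> measurable_fun A f ->
  (forall x, A x -> `|f x - c| <= e) ->
  exists2 J : R, (\int[mu]_(x in A) (f x)%:E = J%:E)%E & `|J - c * m| <= e * m.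
Proof.
move=> mA mAm mf fc.
have fin : (mu A < +oo)%E by rewrite mAm ltry.
have int_cst (k : R) : mu.-integrable A (EFin \o cst k).
  apply: measurable_bounded_integrable => //.
  exact: bounded_cst.
have intf : mu.-integrable A (EFin \o f).
  apply: measurable_bounded_integrable => //.
  exists (`|c| + e); split; first exact: num_real.
  move=> M cM x Ax /=; apply/ltW/(le_lt_trans _ cM).
  rewrite -[f x](subrK c) (le_trans (ler_normD _ _))// addrC lerD2l.
  exact: fc.
have := integrable_fin_num mA intf; set J := (\int[mu]_(x in A) _)%E => Jfin.
exists (fine J); first by rewrite fineK.
have lo : (((c - e) * m)%:E <= J)%E.
  rewrite EFinM -mAm -[leLHS](integral_cst mu mA).
  apply: le_integral => //; first exact: int_cst.
  move=> x /set_mem Ax; rewrite lee_fin.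
  by have := fc x Ax; rewrite ler_norml; lra.
have hi : (J <= ((c + e) * m)%:E)%E.
  rewrite EFinM -mAm -[leRHS](integral_cst mu mA).
  apply: le_integral => //; first exact: int_cst.
  move=> x /set_mem Ax; rewrite lee_fin.
  by have := fc x Ax; rewrite ler_norml; lra.
move: lo hi; rewrite -[J]fineK// !lee_fin ler_norml => lo hi.
by apply/andP; split; lra.
Qed.

(** Riemann-sum estimate for [mu], obtained by adding up [integral_near_cst] over the pieces. *)
Lemma integral_partition (I : finType) (F : I -> set T) (f : T -> R)
    (c m : I -> R) (e : R) (D := \big[setU/set0]_(i <- enum I) F i) :
  (forall i, measurable (F i)) -> trivIset setT F ->
  (forall i, mu (F i) = (m i)%:E) -> measurable_fun D f ->
  (forall i x, F i x -> `|f x - c i| <= e) ->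
  exists2 J : R, (\int[mu]_(x in D) (f x)%:E = J%:E)%E &
    `|J - \sum_i c i * m i| <= e * \sum_i m i.
Proof.
move=> mF tF muF mf fc.
have /choice[J JE] i : exists J : R,
    (\int[mu]_(x in F i) (f x)%:E = J%:E)%E /\ `|J - c i * m i| <= e * m i.
  have mfi : measurable_fun (F i) f.
    apply: measurable_funS mf; first exact: bigsetU_measurable.
    by rewrite /D -bigcup_seq => x Fx; exists i => //=; rewrite mem_enum.
  by have [J J1 J2] := integral_near_cst (mF i) (muF i) mfi (fc i); exists J.
exists (\sum_i J i).
  rewrite /D integral_bigsetU_EFin ?enum_uniq//; last 2 first.
  - exact: sub_trivIset tF.
  - exact/measurable_EFinP.
  rewrite -sumEFin big_enum/=; apply: eq_bigr => i _; exact: (JE i).1.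
rewrite -sumrB mulr_sumr (le_trans (ler_norm_sum _ _ _))// ler_sum// => i _.
exact: (JE i).2.
Qed.

(** Proved for nonnegative functions first, then for f through its positive and negative parts. *)
Lemma integral_finite_dirac (D : set T) (k : {nonneg R}) (s : seq T) (t0 : T)
    (f : T -> R) :
  measurable D -> measurable_fun D f -> {in s, forall x, D x} ->
  (\int[mscale k (msum (fun n => dirac (nth t0 s n)) (size s))]_(x in D)
     (f x)%:E = (k%:num * \sum_(x <- s) f x)%:E)%E.
Proof.
move=> mD mf sD.
have ge0 (g : T -> \bar R) : measurable_fun D g -> (forall x, 0 <= g x)%E ->
    (\int[mscale k (msum (fun n => dirac (nth t0 s n)) (size s))]_(x in D) g x =
     k%:num%:E * \sum_(x <- s) g x)%E.
  move=> mg g0; rewrite ge0_integral_mscale//; congr (_ * _)%E.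
  rewrite ge0_integral_measure_sum// (big_nth t0) big_mkord.
  apply: eq_bigr => i _; rewrite integral_dirac// diracE mem_set ?mul1e//.
  by apply: sD; exact: mem_nth.
have mEf : measurable_fun D (EFin \o f) by exact/measurable_EFinP.
rewrite integralE ge0//; last exact: measurable_funepos.
rewrite ge0//; last exact: measurable_funeneg.
have sumE (g : T -> R) : (\sum_(x <- s) (g x)%:E = (\sum_(x <- s) g x)%:E)%E.
  by rewrite sumEFin.
rewrite (eq_bigr (fun x => (Num.max (f x) 0)%:E)); last first.
  by move=> x _; rewrite funeposE EFin_max.
rewrite [X in (_ - _ * X)%E](eq_bigr (fun x => (Num.max (- f x) 0)%:E)); last first.
  by move=> x _; rewrite funenegE EFin_max.
rewrite !sumE -!EFinM -EFinB -mulrBr -sumrB; congr (_ * _)%:E.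
apply: eq_bigr => x _; have [f0|/ltW f0] := leP 0 (f x).
  by rewrite max_r ?oppr_le0// subr0.
by rewrite max_l ?oppr_ge0// sub0r opprK.
Qed.

End Partition.

(** * Integrals against the scaled counting function *)

Section ScaledCount.
Variables (R : realType) (d : nat).

Lemma counting_seq (T : choiceType) (s : seq T) : uniq s ->
  counting [set` s] = (size s)%:R%:E :> \bar R.
Proof.
move=> us; rewrite /counting asboolT; last exact: finite_seq.
have -> : [set` s] = [set` [fset x in s]%fset].
  by apply/seteqP; split=> x /=; rewrite inE.
by rewrite set_fsetK card_fseq undup_id.
Qed.

(** The list s enumerates the preimages of X in the cube. By injectivity of phi, [scaled_count] is a
    multiple of the sum of the Dirac measures at s, hence a genuine measure. *)
Lemma scaled_count_integral (X : set 'rV[R]_d) (phi : 'rV[R]_d -> 'rV[R]_d)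
    (r : R) (s : seq 'rV[R]_d) (f : 'rV[R]_d -> R) :
  0 < r -> uniq s -> {in cube d 1 &, injective phi} ->
  (forall x, x \in s <-> cube d 1 x /\ X (phi x)) ->
  measurable_fun (cube d 1 : set (lebesgueType R d)) f ->
  (\int[scaled_count X phi r]_(x in cube d 1) (f x)%:E =
   ((r ^+ d)^-1 * \sum_(x <- s) f x)%:E)%E.
Proof.
move=> r0 us phi_inj sE mf.
have k0 : 0 <= (r ^+ d)^-1 by rewrite invr_ge0 exprn_ge0 ?ltW.
pose k : {nonneg R} := NngNum k0.
have -> : scaled_count X phi r =
    mscale k (msum (fun n => dirac (nth (0 : lebesgueType R d) s n)) (size s)).
  apply/funext => A; rewrite /scaled_count /mscale/= muleC; congr (_ * _)%E.
  pose t := [seq phi x | x <- s & x \in A].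
  have -> : X `&` phi @` (A `&` cube d 1) = [set` t].
    apply/seteqP; split=> [y [Xy [x [Ax x01] xy]]|y /= /mapP[x]].
      rewrite -xy in Xy *.
      apply/mapP; exists x => //; rewrite mem_filter mem_set//=.
      exact/sE.
    rewrite mem_filter => /andP[/set_mem Ax /sE[x01 Xx]] ->; split => //.
    by exists x.
  rewrite counting_seq; last first.
    rewrite map_inj_in_uniq ?filter_uniq// => x y.
    rewrite !mem_filter => /andP[_ /sE[x01 _]] /andP[_ /sE[y01 _]].
    by apply: phi_inj; exact: mem_set.
  rewrite size_map size_filter /msum.
  transitivity (\sum_(x <- s) (\1_A x)%:E : \bar R)%E; last first.
    by rewrite (big_nth (0 : lebesgueType R d)) big_mkord.
  rewrite sumEFin; congr (_%:E).
  rewrite -sum1_count natr_sum big_mkcond/=; apply: eq_bigr => x _.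
  by rewrite indicE; case: (x \in A).
rewrite integral_finite_dirac//; first exact: measurable_cube.
by move=> x /sE[].
Qed.

End ScaledCount.

(** * The measure with density rho *)

Section Density.
Variables (R : realType) (d : nat) (rho : lebesgueType R d -> R).
Hypothesis rho_meas : measurable_fun (cube d 1 : set (lebesgueType R d)) rho.
Hypothesis rho_bnd : forall x, cube d 1 x -> 4 / 3 <= rho x <= 5 / 3.

Local Notation D := (cube d 1 : set (lebesgueType R d)).
Local Notation nu := (density_measure rho).

Let rho_ge0 x : D x -> (0 <= (rho x)%:E)%E.
Proof. by move=> /rho_bnd /andP[rx _]; rewrite lee_fin; lra. Qed.

Let nu0 : nu set0 = 0%E.
Proof. by rewrite /density_measure set0I integral_set0. Qed.

Let nu_ge0 A : (0 <= nu A)%E.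
Proof. by apply: integral_ge0 => x [_ Dx]; exact: rho_ge0. Qed.

Let nu_sigma_additive : semi_sigma_additive nu.
Proof.
move=> F mF tF mUF; rewrite /density_measure setI_bigcupl.
have mFD i : measurable (F i `&` D) by apply: measurableI => //; exact: measurable_cube.
rewrite ge0_integral_bigcup//; last 3 first.
- apply/measurable_EFinP; apply: measurable_funS rho_meas.
    exact: measurable_cube.
  by move=> x [i _ []].
- by move=> x [i _ [_ Dx]]; exact: rho_ge0.
- apply/trivIsetP => i j _ _ ij; rewrite setIACA setIid.
  by move/trivIsetP : tF => /(_ i j I I ij) ->; rewrite set0I.
apply: is_cvg_ereal_nneg_natsum => i _.
by apply: integral_ge0 => x [_ Dx]; exact: rho_ge0.
Qed.

HB.instance Definition _ := isMeasure.Build _ _ _ nu nu0 nu_ge0 nu_sigma_additive.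

Variable h : nat.

Definition cell_mass (j : {ffun 'I_d -> 'I_h.+1}) : R := fine (nu (cell j)).

Lemma cell_massE j : nu (cell j) = (cell_mass j)%:E /\
  4 / 3 / h.+1%:R ^+ d <= cell_mass j <= 5 / 3 / h.+1%:R ^+ d.
Proof.
have jD : cell j `<=` D by exact: cell_sub.
have mj : measurable (cell j : set (lebesgueType R d)) by exact: measurable_cell.
have lj : lebesgue R d (cell j) = (h.+1%:R ^- d)%:E by exact: lebesgue_cell.
have mrho : measurable_fun (cell j : set (lebesgueType R d)) rho.
  by apply: measurable_funS rho_meas => //; exact: measurable_cube.
(* 3/2 is the midpoint and 1/6 the half-length of [4/3, 5/3], so both bounds on the mass come from
   one estimate. *)
have rhoj x : cell j x -> `|rho x - 3 / 2| <= 1 / 6.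
  by move=> /jD/rho_bnd; rewrite ler_norml; lra.
have [J J1] := integral_near_cst mj lj mrho rhoj.
have jE : nu (cell j) = J%:E.
  rewrite /density_measure (_ : cell j `&` cube d 1 = cell j)//.
  exact/setIidPl.
rewrite /cell_mass jE/= -!mulrA ler_norml => /andP[? ?]; split => //.
by apply/andP; split; lra.
Qed.

Lemma density_integral (f : 'rV[R]_d -> R) (e : R) :
  {within cube d 1, continuous f} ->
  (forall (j : {ffun 'I_d -> 'I_h.+1}) x, cell j x ->
    `|f x - f (cell_corner R j)| <= e) -> 0 <= e ->
  exists2 J : R, (\int[nu]_(x in cube d 1) (f x)%:E = J%:E)%E &
    `|J - \sum_(j : {ffun 'I_d -> 'I_h.+1}) f (cell_corner R j) * cell_mass j|
      <= e * (5 / 3).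
Proof.
move=> cf fe e0; rewrite (cube_cells R d (ltn0Sn h)).
have mf : measurable_fun (\big[setU/set0]_(j <- enum {ffun 'I_d -> 'I_h.+1}) cell j
    : set (lebesgueType R d)) f.
  by rewrite -cube_cells//; exact: cube_continuous_measurable.
have mc (j : {ffun 'I_d -> 'I_h.+1}) : measurable (cell j : set (lebesgueType R d)).
  exact: measurable_cell.
have tc : trivIset [set: {ffun 'I_d -> 'I_h.+1}] (fun j => cell j : set 'rV[R]_d).
  exact: trivIset_cell.
have [J J1 J2] := integral_partition (mu := nu) mc tc (fun j => (cell_massE j).1) mf fe.
exists J => //; apply: (le_trans J2); rewrite ler_wpM2l//.
apply: (@le_trans _ _ (\sum_(j : {ffun 'I_d -> 'I_h.+1}) 5 / 3 / h.+1%:R ^+ d)).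
  by apply: ler_sum => j _; have [_ /andP[]] := cell_massE j.
rewrite sumr_const card_ffun !card_ord -[leLHS]mulr_natr natrX mulfVK//.
Qed.

End Density.

(** * Densities of the blocks *)

Section Balanced.
Variable R : realType.

(** Choose b when the running sum is at most 0 and a otherwise. Each term then pushes the sum
    towards or across 0 by at most b - a <= 1, so it never leaves [-1, 1]. *)
Lemma greedy_balanced (T : eqType) (s : seq T) (a b t : R) :
  uniq s -> a <= t <= b -> b - a <= 1 ->
  exists P : T -> bool, `|\sum_(x <- s) ((if P x then b else a) - t)| <= 1.
Proof.
move=> us /andP[at_ tb] ba; elim: s us => [_|x s IH /= /andP[xs us]].
  by exists (fun=> true); rewrite big_nil normr0.
have [P] := IH us; set S := \sum_(y <- s) _ => PS.
have ext c : \sum_(y <- x :: s) ((if (if y == x then c else P y) then b else a) - t)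
    = ((if c then b else a) - t) + S.
  rewrite big_cons eqxx; congr (_ + _); apply: eq_big_seq => y ys.
  by case: eqP ys xs => // -> ->.
move: PS; rewrite ler_norml => /andP[S1 S2].
exists (fun y => if y == x then S <= 0 else P y); rewrite ext ler_norml.
by case: (leP S 0) => S0; apply/andP; split; lra.
Qed.

Variable d : nat.

Definition balanced n (a b t : R) (P : 'rV[int]_d -> bool) : Prop :=
  `|\sum_(y : {ffun 'I_d -> 'I_n}) ((if P (box_pt y) then b else a) - t)| <= 1.

(** Made total by a default value: the inequalities a <= t <= b can be proved only after the
    colouring that uses these patterns has been defined. *)
Definition balanced_pattern n (a b t : R) : 'rV[int]_d -> bool :=
  if pselect (exists P, balanced n a b t P) is left e then projT1 (cid e)
  else fun=> false.

Lemma balanced_patternP n (a b t : R) : a <= t <= b -> b - a <= 1 ->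
  balanced n a b t (balanced_pattern n a b t).
Proof.
move=> atb ba; rewrite /balanced_pattern.
case: pselect => [e|[]]; first by case: cid.
have [|P PS] :=
    @greedy_balanced _ [seq box_pt y | y : {ffun 'I_d -> 'I_n}] a b t _ atb ba.
  by rewrite map_inj_uniq ?enum_uniq//; exact: box_pt_inj.
by exists P; move: PS; rewrite big_map big_enum.
Qed.

End Balanced.

(** * Block densities and the coarse cells of mixed blocks *)

Section Densities.
Variables (R : realType) (d : nat) (g : nat -> nat) (tgt : nat -> 'rV[int]_d -> R).

(** A square: along each side there are g n + 1 coarse cells, each made of g n + 1 subblocks. *)
Definition branching n := ((g n).+1 ^ 2)%N.
Local Notation N := branching.
Local Notation K := #|{: slot d}|.

(** Stated for a colouring instead of a tile, because [mixed_pattern] needs densities before [block]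
    can be instantiated with it. *)
Definition density_of n (c : 'rV[int]_d -> bool) : R :=
  (\sum_(v : {ffun 'I_d -> 'I_(side N n)}) c (box_pt v))%N%:R / (side N n)%:R ^+ d.

Definition mixed_pattern n (c : tile -> 'rV[int]_d -> bool) (x : 'rV[int]_d) : bool :=
  balanced_pattern (g n).+1 (density_of n (c (Some false)))
    (density_of n (c (Some true))) (tgt n (vdiv (g n).+1 x)) (vmod (g n).+1 x).

Local Notation pat := mixed_pattern.

Hypothesis d_gt0 : (0 < d)%N.
Hypothesis N_big : forall n, big_enough d (N n).
Hypothesis N_sum : forall n, \sum_(i < n) K%:R / (N i)%:R ^+ d <= 1 / 3 :> R.
Hypothesis tgt_itv : forall n j, 1 / 3 <= tgt n j <= 2 / 3.

Definition density n t : R := density_of n (block N pat n t).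

Lemma densityE n t : density n t = (block_count N pat n t)%:R / (side N n)%:R ^+ d.
Proof. by []. Qed.

Let N0 n : 0 < (N n)%:R :> R.
Proof. by rewrite ltr0n (ltn_trans _ (branch_gt1 N_big n)). Qed.

Let L0 n : 0 < (side N n)%:R ^+ d :> R.
Proof. by rewrite exprn_gt0// ltr0n (side_gt0 N_big). Qed.

Let Nd0 n : 0 < (N n)%:R ^+ d :> R.
Proof. by rewrite exprn_gt0. Qed.

Lemma density_itv n t : 0 <= density n t <= 1.
Proof.
rewrite densityE divr_ge0 ?(ltW (L0 n))//= ler_pdivrMr// mul1r -natrX ler_nat.
exact: block_count_le.
Qed.

(** The density is 0 at level 0, and by [block_count_low] the step from n to n+1 adds at most K /
    N_n^d. High blocks start at density 1 and lose at most the same amounts. *)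
Lemma density_low n : density n (Some false) <= 1 / 3.
Proof.
apply: le_trans (N_sum n).
elim: n => [|n IH].
  rewrite big_ord0 densityE /block_count big1 ?mul0r// => v _.
rewrite big_ord_recr/= -lerBlDr; apply: le_trans IH.
rewrite !densityE /= natrM exprMn lerBlDr.
have -> : (block_count N pat n (Some false))%:R / (side N n)%:R ^+ d
    + K%:R / (N n)%:R ^+ d =
    ((N n)%:R ^+ d * (block_count N pat n (Some false))%:R
      + K%:R * (side N n)%:R ^+ d) / ((N n)%:R ^+ d * (side N n)%:R ^+ d) :> R.
  move: (L0 n) (Nd0 n); set l := _ ^+ d; set m := _ ^+ d => l0 m0.
  by field; rewrite !lt0r_neq0.
rewrite ler_pM2r ?invr_gt0 ?mulr_gt0//.
rewrite -!natrX -!natrM -natrD ler_nat.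
exact: block_count_low.
Qed.

Lemma density_high n : 2 / 3 <= density n (Some true).
Proof.
suff : 1 - \sum_(i < n) K%:R / (N i)%:R ^+ d <= density n (Some true).
  by have := N_sum n; lra.
elim: n => [|n IH].
  rewrite big_ord0 subr0 densityE /block_count /= expr1n divr1.
  rewrite (eq_bigr (fun=> 1%N))// sum1_card card_ffun !card_ord exp1n; lra.
rewrite big_ord_recr/= opprD addrA lerBlDr; apply: (le_trans IH).
rewrite !densityE /= natrM exprMn.
have -> : (block_count N pat n.+1 (Some true))%:R
      / ((N n)%:R ^+ d * (side N n)%:R ^+ d) + K%:R / (N n)%:R ^+ d =
    ((block_count N pat n.+1 (Some true))%:R
      + K%:R * (side N n)%:R ^+ d) / ((N n)%:R ^+ d * (side N n)%:R ^+ d) :> R.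
  move: (L0 n) (Nd0 n); set l := _ ^+ d; set m := _ ^+ d => l0 m0.
  by field; rewrite !lt0r_neq0.
rewrite ler_pdivlMr ?mulr_gt0// mulrCA mulrA -mulrA mulfVK ?lt0r_neq0//.
rewrite -!natrX -!natrM -natrD ler_nat.
exact: block_count_high.
Qed.

(* The number of points of a mixed level-(n+1) block in the coarse cell [j]:
   every unit cell carries one point, and a second one if it has colour true. *)
Definition cell_count n (j : {ffun 'I_d -> 'I_(g n).+1}) : nat :=
  (\sum_(y : {ffun 'I_d -> 'I_(g n).+1}) \sum_(u : {ffun 'I_d -> 'I_(side N n)})
    (1 + block N pat n.+1 None
      ((side N n)%:Z *: ((g n).+1%:Z *: box_pt j + box_pt y) + box_pt u)))%N.

Let fine_pt n (j y : {ffun 'I_d -> 'I_(g n).+1}) : 'rV[int]_d :=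
  (g n).+1%:Z *: box_pt j + box_pt y.

Let fine_pt_itv n (j y : {ffun 'I_d -> 'I_(g n).+1}) i :
  0 <= fine_pt j y ord0 i < (N n)%:Z.
Proof.
rewrite /fine_pt !mxE /N; have := ltn_ord (j i); have := ltn_ord (y i).
by move: (j i : nat) (y i : nat) => a b; nia.
Qed.

Lemma cell_count_reserved n (j : {ffun 'I_d -> 'I_(g n).+1}) :
  (\sum_(y : {ffun 'I_d -> 'I_(g n).+1})
     (reserved (N n) ((g n).+1%:Z *: box_pt j + box_pt y) : bool) <= K)%N.
Proof.
apply: leq_trans (card_reserved d_gt0 (N n)).
rewrite -sum1_card [leqRHS]big_mkcond/=.
rewrite [leqRHS](eq_bigr (fun v : {ffun 'I_d -> 'I_(N n)} =>
    nat_of_bool (reserved (N n) (box_pt v)))); last first.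
  by move=> v _; rewrite inE; case: (reserved _ _).
rewrite /N expnS expn1 (sum_box_mul _ (fun v => nat_of_bool (reserved _ v)))//.
by rewrite [leqRHS](bigD1 j)//= leq_addr.
Qed.

(** [H] is the number of coarse cells and also the number of subblocks in each. Measured in
    subblocks, the greedy choice is off by at most 1 and each reserved position by at most 1; the
    whole block has H^2 subblocks. The 1 added to [tgt] counts the point that every unit cell
    carries. *)
Lemma cell_count_near n (j : {ffun 'I_d -> 'I_(g n).+1}) (H := (g n).+1%:R ^+ d : R) :
  `|(cell_count j)%:R / (side N n.+1)%:R ^+ d - (tgt n (box_pt j) + 1) / H|
    <= (K%:R + 1) / H ^+ 2.
Proof.
have H0 : 0 < H by rewrite exprn_gt0// ltr0n.
set L := (side N n)%:R ^+ d : R; have LL : 0 < L by exact: L0.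
pose st y := subtile N pat n (block N pat n) None (fine_pt j y).
have ccE : (cell_count j)%:R = L * (H + \sum_y density n (st y)).
  rewrite /cell_count mulrDr mulr_sumr.
  rewrite (eq_bigr (fun y => (side N n ^ d + block_count N pat n (st y))%N));
    last first.
    move=> y _; rewrite big_split/= sum1_card card_ffun !card_ord; congr (_ + _)%N.
    apply: eq_bigr => u _.
    rewrite -/(fine_pt j y) vdivD ?(side_gt0 N_big)// vdiv_box addr0.
    by rewrite vmod_small// block_period.
  rewrite big_split/= sum_nat_const card_ffun !card_ord natrD natrM !natrX mulrC.
  congr (_ + _); rewrite natr_sum; apply: eq_bigr => y _.
  by rewrite densityE -/L mulrCA divff ?mulr1// lt0r_neq0.
have NE : (side N n.+1)%:R ^+ d = H ^+ 2 * L.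
  by rewrite /= natrM exprMn /N natrX exprAC.
rewrite ccE NE.
have -> : L * (H + \sum_y density n (st y)) / (H ^+ 2 * L)
      - (tgt n (box_pt j) + 1) / H =
    (\sum_y density n (st y) - H * tgt n (box_pt j)) / H ^+ 2.
  by field; rewrite !lt0r_neq0.
rewrite normrM (ger0_norm (_ : 0 <= (H ^+ 2)^-1)); last by rewrite invr_ge0 sqr_ge0.
rewrite ler_pM2r ?invr_gt0 ?exprn_gt0//.
set a := density n (Some false); set b := density n (Some true).
pose P : 'rV[int]_d -> bool := balanced_pattern (g n).+1 a b (tgt n (box_pt j)).
have bal : balanced (g n).+1 a b (tgt n (box_pt j)) P.
  apply: balanced_patternP.
    have := tgt_itv n (box_pt j); have := density_low n; have := density_high n.
    by rewrite -/a -/b; lra.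
  have := density_itv n (Some false); have := density_itv n (Some true).
  by rewrite -/a -/b; lra.
(* The first sum is nonzero only at reserved positions; the second is the error of the greedy
   pattern. *)
have -> : \sum_y density n (st y) - H * tgt n (box_pt j) =
    \sum_y (density n (st y) - (if P (box_pt y) then b else a)) +
    \sum_(y : {ffun 'I_d -> 'I_(g n).+1})
      ((if P (box_pt y) then b else a) - tgt n (box_pt j)).
  rewrite -big_split/= [RHS](eq_bigr (fun y => density n (st y) - tgt n (box_pt j))).
    by rewrite sumrB sumr_const card_ffun !card_ord -[in RHS]mulr_natl natrX.
  by move=> y _; rewrite addrA subrK.
rewrite (le_trans (ler_normD _ _))// lerD//.
have := cell_count_reserved j; rewrite -(ler_nat R) natr_sum; apply: le_trans.
rewrite (le_trans (ler_norm_sum _ _ _))// ler_sum// => y _.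
rewrite /st /subtile -/(fine_pt j y); case: reserved => [t|] /=.
  have := density_itv n t; have := density_itv n (Some (P (box_pt y))).
  by rewrite ler_norml; case: (P _); rewrite -/a -/b; lra.
rewrite /mixed_pattern -[density_of n _]/a -[density_of n (block _ _ _ (Some true))]/b.
rewrite /fine_pt vdivD// vmodD vdiv_box vmod_box addr0 -/P.
by case: (P _); rewrite subrr normr0.
Qed.

End Densities.

(** * Encoding *)

Lemma cell_pt_inj (R : realType) d z z' b b' : (0 < d)%N ->
  @cell_pt R d z b = cell_pt R z' b' -> z = z' /\ b = b'.
Proof.
move=> d0 /rowP zz'.
have fl y c i : Num.floor (@cell_pt R d y c ord0 i) = y ord0 i.
  apply: Num.Theory.floor_def; rewrite mxE rmorphD/=.
  by have /andP[c0 c1] := shift_frac_itv R c; apply/andP; split; lra.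
have zE : z = z' by apply/rowP => i; rewrite -(fl z b) -(fl z' b') zz'.
split=> //; have := zz' (Ordinal d0); rewrite zE !mxE => /addrI.
by move: b b' {zE fl zz'} => [] []//; rewrite /shift_frac => ?; exfalso; lra.
Qed.

Section Encoding.
Variables (R : realType) (d : nat) (rho : lebesgueType R d -> R) (g : nat -> nat).
Local Notation N := (branching g).
Local Notation K := #|{: slot d}|.

Hypothesis rho_meas : measurable_fun (cube d 1 : set (lebesgueType R d)) rho.
Hypothesis rho_bnd : forall x, cube d 1 x -> 4 / 3 <= rho x <= 5 / 3.
Hypothesis d_gt0 : (0 < d)%N.
Hypothesis N_big : forall n, big_enough d (N n).
Hypothesis N_sum : forall n, \sum_(i < n) K%:R / (N i)%:R ^+ d <= 1 / 3 :> R.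

(** Total left inverse of [box_pt]; through it the bounds on [target] hold at every integer
    vector. *)
Definition unbox n (j : 'rV[int]_d) : {ffun 'I_d -> 'I_n.+1} :=
  [ffun i => inord `|j ord0 i|].

Lemma box_ptK n : cancel (@box_pt d n.+1) (unbox n).
Proof. by move=> v; apply/ffunP => i; rewrite ffunE mxE absz_nat inord_val. Qed.

(** The mean of rho over the cell, minus 1 for the point present in every unit cell; this maps
    [4/3, 5/3] to [1/3, 2/3]. *)
Definition target n (j : 'rV[int]_d) : R :=
  (g n).+1%:R ^+ d * cell_mass rho (unbox (g n) j) - 1.

Local Notation pat := (mixed_pattern g target).
Local Notation Lt n := (side N n.+1).

Lemma target_itv n j : 1 / 3 <= target n j <= 2 / 3.
Proof.
have [_ /andP[]] := cell_massE rho_meas rho_bnd (unbox (g n) j).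
have H0 : 0 < (g n).+1%:R ^+ d :> R by rewrite exprn_gt0// ltr0n.
rewrite /target ler_pdivrMr// ler_pdivlMr// mulrC => m1 m2.
by apply/andP; split; lra.
Qed.

Let Lt0 n : 0 < (Lt n)%:R :> R.
Proof. by rewrite ltr0n (side_gt0 N_big). Qed.

Definition unit_pt n z b : 'rV[R]_d := (Lt n)%:R^-1 *: cell_pt R z b.

Lemma unit_pt_inj n z b z' b' : unit_pt n z b = unit_pt n z' b' -> z = z' /\ b = b'.
Proof.
move=> /scalerI; rewrite invr_eq0 gt_eqF// => /(_ isT).
exact: cell_pt_inj.
Qed.

Lemma unit_pt_cell n (j y : {ffun 'I_d -> 'I_(g n).+1})
    (u : {ffun 'I_d -> 'I_(side N n)}) b :
  cell j (unit_pt n ((side N n)%:Z *: ((g n).+1%:Z *: box_pt j + box_pt y)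
    + box_pt u) b).
Proof.
move=> i; rewrite /cell_itv in_itv/= !mxE.
set H := (g n).+1; set L := side N n.
pose a := (L * (H * j i + y i) + u i)%N.
rewrite (_ : _ * (_ * _ + _) + _ = a%:Z); last by rewrite /a !(PoszD, PoszM).
have LtE : (N n * L)%N%:R = H%:R * (H%:R * L%:R) :> R.
  by rewrite -!natrM /branching expnS expn1 mulnA.
have H0 : 0 < H%:R :> R by rewrite ltr0n.
have L0 : 0 < L%:R :> R by rewrite ltr0n (side_gt0 N_big).
have uL : (u i < L)%N := ltn_ord _.
have yH : (y i < H)%N := ltn_ord _.
have a1 : (j i)%:R * (H%:R * L%:R) <= a%:R :> R.
  by rewrite -!natrM ler_nat /a; nia.
have a2 : a%:R + 1 <= (j i).+1%:R * (H%:R * L%:R) :> R.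
  by rewrite natr1 -!natrM ler_nat /a; nia.
have /andP[b0 b1] := shift_frac_itv R b.
rewrite -/L LtE; set t := a%:R + shift_frac R b; set c := H%:R * L%:R in a1 a2 *.
have c0 : 0 < c by rewrite mulr_gt0.
have -> : (H%:R * c)^-1 * t = (t / c) / H%:R by field; rewrite !gt_eqF.
have tj : t / c / H%:R < (j i).+1%:R / H%:R.
  by rewrite ltr_pM2r ?invr_gt0// ltr_pdivrMr//; rewrite /t; lra.
rewrite ler_pM2r ?invr_gt0// ler_pdivlMr// (le_trans a1)/=; last by rewrite /t; lra.
by case: (_ != _) => //=; exact: ltW.
Qed.

Definition offset (k : nat -> 'rV[int]_d) n : 'rV[R]_d :=
  map_mx intr ((Lt n)%:Z *: k n).

Definition block_map k n (x : 'rV[R]_d) : 'rV[R]_d := offset k n + (Lt n)%:R *: x.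

Lemma block_map_unit_pt k n z b :
  block_map k n (unit_pt n z b) = cell_pt R ((Lt n)%:Z *: k n + z) b.
Proof. by rewrite /block_map /unit_pt scalerA divff ?gt_eqF// scale1r cell_ptD. Qed.

Lemma block_map_inj k n : injective (block_map k n).
Proof. by move=> x y /addrI/scalerI; apply; rewrite gt_eqF. Qed.

Definition block_pts n : seq 'rV[R]_d :=
  [seq unit_pt n (box_pt v.1) v.2
  | v <- enum {: {ffun 'I_d -> 'I_(Lt n)} * bool}
  & v.2 ==> block N pat n.+1 None (box_pt v.1)].

Lemma block_pts_uniq n : uniq (block_pts n).
Proof.
rewrite map_inj_uniq; first exact/filter_uniq/enum_uniq.
by move=> [v b] [v' b'] /unit_pt_inj[/= /box_pt_inj -> ->].
Qed.

Lemma mem_block_pts k n (x : 'rV[R]_d) :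
  (forall z, vdiv (Lt n) z = k n -> colouring N pat z = block N pat n.+1 None z) ->
  x \in block_pts n <->
  cube d 1 x /\ point_set (colouring N pat) (block_map k n x).
Proof.
move=> kE; have L1 : 0 < (N n * side N n)%:R :> R := Lt0 n; split.
  move=> /mapP[[v b]]; rewrite mem_filter/= => /andP[vb _] ->; split.
    move=> i; rewrite !mxE.
    have /andP[b0 b1] := shift_frac_itv R b.
    have vL : (v i).+1%:R <= (N n * side N n)%:R :> R.
      by rewrite ler_nat; exact: ltn_ord (v i).
    rewrite mulr_ge0 ?invr_ge0 ?(ltW (Lt0 n)) ?addr_ge0 ?(ltW b0)//=.
    by rewrite ler_pdivrMl// mulr1; move: vL; rewrite -natr1; lra.
  rewrite block_map_unit_pt; exists ((Lt n)%:Z *: k n + box_pt v), b; split=> //.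
  move=> b1; move: vb; rewrite b1/= => vb.
  rewrite kE; last by rewrite vdivD ?(side_gt0 N_big)// vdiv_box addr0.
  by rewrite block_period.
move=> [x01 [z [b [bz xz]]]].
pose u := z - (Lt n)%:Z *: k n.
have zE : z = (Lt n)%:Z *: k n + u by rewrite addrC subrK.
clearbody u.
have xE : x = unit_pt n u b.
  by apply: (@block_map_inj k n); rewrite block_map_unit_pt -zE.
(* The fractional shift lies strictly between 0 and 1, so no point of X lies on the boundary of the
   closed block and u is in the half-open box. *)
have u_itv i : 0 <= u ord0 i < (Lt n)%:Z.
  have := x01 i; rewrite xE !mxE => /andP[].
  have /andP[b0 b1] := shift_frac_itv R b.
  rewrite pmulr_rge0 ?invr_gt0// ler_pdivrMl// mulr1 => u0 u1.
  have {}u1 : (u ord0 i)%:~R < (Lt n)%:Z%:~R :> R by apply: lt_le_trans u1; lra.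
  have {}u0 : 0 < (u ord0 i + 1)%:~R :> R by rewrite rmorphD rmorph1; lra.
  by move: u0 u1; rewrite ltr0z ltr_int ltzD1 => -> ->.
have uL i : (`|u ord0 i| < Lt n)%N by have := u_itv i; lia.
pose v : {ffun 'I_d -> 'I_(Lt n)} := [ffun i => Ordinal (uL i)].
have uE : u = box_pt v.
  by apply/rowP => i; rewrite [RHS]mxE ffunE/= gez0_abs//; case/andP: (u_itv i).
apply/mapP; exists (v, b); last by rewrite xE uE.
rewrite mem_filter mem_enum andbT; apply/implyP => /bz; rewrite kE.
  by rewrite zE uE block_period.
by rewrite zE vdivD ?(side_gt0 N_big)// uE vdiv_box addr0.
Qed.

Let weighted n (f : 'rV[R]_d -> R) z : R :=
  f (unit_pt n z false) + (if block N pat n.+1 None z then f (unit_pt n z true) else 0).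

Lemma sum_block_pts n (f : 'rV[R]_d -> R) :
  \sum_(x <- block_pts n) f x =
  \sum_(v : {ffun 'I_d -> 'I_(Lt n)}) weighted n f (box_pt v).
Proof.
rewrite /block_pts big_map big_filter big_enum_cond/= big_mkcond/=.
rewrite -(pair_bigA _ (fun (v : {ffun 'I_d -> 'I_(Lt n)}) (b : bool) =>
  if b ==> block N pat n.+1 None (box_pt v) then f (unit_pt n (box_pt v) b) else 0)).
by apply: eq_bigr => v _; rewrite big_bool/= addrC.
Qed.

(** Replacing f by its corner values costs at most 2e, since a unit cell has at most two points. The
    rest is [cell_count_near] summed over the (g n + 1)^d coarse cells. *)
Lemma sum_block_pts_near n (f : 'rV[R]_d -> R) (e B : R) :
  0 <= e ->
  (forall (j : {ffun 'I_d -> 'I_(g n).+1}) x, cell j x ->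
    `|f x - f (cell_corner R j)| <= e) ->
  (forall j : {ffun 'I_d -> 'I_(g n).+1}, `|f (cell_corner R j)| <= B) ->
  `|((Lt n)%:R ^+ d)^-1 * (\sum_(x <- block_pts n) f x) -
    \sum_(j : {ffun 'I_d -> 'I_(g n).+1}) f (cell_corner R j) * cell_mass rho j|
  <= 2 * e + B * ((K%:R + 1) / (g n).+1%:R ^+ d).
Proof.
move=> e0 fe fB; set H := (g n).+1; set L := side N n.
have L0 : (0 < L)%N by exact: side_gt0.
pose cc := @cell_count R d g target n.
have LtE : Lt n = (H * H * L)%N by rewrite /= /branching expnS expn1.
have sumE : \sum_(x <- block_pts n) f x = \sum_(j : {ffun 'I_d -> 'I_H})
    \sum_(y : {ffun 'I_d -> 'I_H}) \sum_(u : {ffun 'I_d -> 'I_L})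
      weighted n f (L%:Z *: (H%:Z *: box_pt j + box_pt y) + box_pt u).
  rewrite sum_block_pts; apply: etrans (sum_box_mul (N n) (weighted n f) L0) _.
  exact: (sum_box_mul H (fun x => \sum_(u : {ffun 'I_d -> 'I_L})
    weighted n f (L%:Z *: x + box_pt u)) (ltn0Sn _)).
have Ltd0 : 0 < (Lt n)%:R ^+ d :> R by rewrite exprn_gt0.
have Hd0 : 0 < H%:R ^+ d :> R by rewrite exprn_gt0// ltr0n.
have cc_le j : (cc j)%:R <= 2 * (H%:R ^+ d * L%:R ^+ d) :> R.
  rewrite -!natrX -!natrM ler_nat /cc /cell_count.
  have -> : (2 * (H ^ d * L ^ d) = \sum_(y : {ffun 'I_d -> 'I_H})
      \sum_(u : {ffun 'I_d -> 'I_L}) 2)%N.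
    by rewrite !sum_nat_const !card_ffun !card_ord; lia.
  by apply: leq_sum => y _; apply: leq_sum => u _; case: block.
have near1 : `|\sum_(x <- block_pts n) f x - \sum_j f (cell_corner R j) * (cc j)%:R|
    <= e * (2 * (Lt n)%:R ^+ d).
  rewrite sumE -sumrB (le_trans (ler_norm_sum _ _ _))//.
  apply: (@le_trans _ _ (\sum_(j : {ffun 'I_d -> 'I_H}) e * (cc j)%:R)).
    apply: ler_sum => j _; rewrite /cc /cell_count natr_sum !mulr_sumr -sumrB.
    rewrite (le_trans (ler_norm_sum _ _ _))// ler_sum// => y _.
    rewrite natr_sum !mulr_sumr -sumrB (le_trans (ler_norm_sum _ _ _))//.
    apply: ler_sum => u _.
    have pc b := @unit_pt_cell n j y u b.
    set z := _ + box_pt u in pc *; rewrite /weighted natrD mulr1n.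
    have := fe j _ (pc false); have := fe j _ (pc true).
    case: (block _ _ _ _ _) => /=; rewrite !ler_norml => /andP[? ?] /andP[? ?];
      by apply/andP; split; lra.
  rewrite -mulr_sumr ler_wpM2l//.
  apply: (@le_trans _ _ (\sum_(j : {ffun 'I_d -> 'I_H}) 2 * (H%:R ^+ d * L%:R ^+ d))).
    exact: ler_sum.
  rewrite sumr_const card_ffun !card_ord -[leLHS]mulr_natl natrX LtE !natrM !exprMn.
  by rewrite le_eqVlt; apply/orP; left; apply/eqP; ring.
have near2 j : `|(cc j)%:R / (Lt n)%:R ^+ d - cell_mass rho j|
    <= (K%:R + 1) / (H%:R ^+ d) ^+ 2.
  have <- : (target n (box_pt j) + 1) / H%:R ^+ d = cell_mass rho j.
    by rewrite /target box_ptK subrK mulrAC divff ?mul1r// lt0r_neq0.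
  exact: (@cell_count_near R d g target d_gt0 N_big N_sum target_itv n j).
have -> : ((Lt n)%:R ^+ d)^-1 * (\sum_(x <- block_pts n) f x) -
    \sum_(j : {ffun 'I_d -> 'I_H}) f (cell_corner R j) * cell_mass rho j =
  ((Lt n)%:R ^+ d)^-1 * (\sum_(x <- block_pts n) f x
    - \sum_j f (cell_corner R j) * (cc j)%:R) +
  \sum_(j : {ffun 'I_d -> 'I_H}) f (cell_corner R j) *
    ((cc j)%:R / (Lt n)%:R ^+ d - cell_mass rho j).
  rewrite [X in _ = _ + X](_ : _ = ((Lt n)%:R ^+ d)^-1 *
      (\sum_j f (cell_corner R j) * (cc j)%:R)
    - \sum_(j : {ffun 'I_d -> 'I_H}) f (cell_corner R j) * cell_mass rho j); last first.
    by rewrite mulr_sumr -sumrB; apply: eq_bigr => j _; ring.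
  by rewrite mulrBr addrA subrK.
rewrite (le_trans (ler_normD _ _))// lerD//.
  rewrite normrM ger0_norm ?invr_ge0 ?(ltW Ltd0)// ler_pdivrMl// (le_trans near1)//.
  by rewrite le_eqVlt; apply/orP; left; apply/eqP; ring.
rewrite (le_trans (ler_norm_sum _ _ _))//.
apply: (@le_trans _ _ (\sum_(j : {ffun 'I_d -> 'I_H})
    B * ((K%:R + 1) / (H%:R ^+ d) ^+ 2))).
  by apply: ler_sum => j _; rewrite normrM ler_pM.
rewrite sumr_const card_ffun !card_ord -[leLHS]mulr_natl natrX.
rewrite le_eqVlt; apply/orP; left; apply/eqP; field; exact: lt0r_neq0.
Qed.

Hypothesis g_infty : forall M, \forall n \near \oo, (M <= g n)%N.

Lemma encodes_colouring : encodes (point_set (colouring N pat)) rho.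
Proof.
(* [k n] is the position of a mixed level-(n+1) block; the closed cube spanned by this block is
   Q_n. *)
have [k kE] := choice (fun n => colouring_has_tile pat N_big d_gt0 n.+1 None).
exists (fun n => (Lt n)%:R), (fun n => block_map k n @` cube d 1), (block_map k).
split=> //.
- apply/cvgryPge => A; near=> n.
  rewrite (@le_trans _ _ n%:R)//; first by near: n; exact: nbhs_infty_ger.
  by rewrite ler_nat ltnW// ltnW// (side_gt N_big).
- move=> n; exists (offset k n), 1%:M; rewrite trmx1 mulmx1; split=> //.
  have L0 := Lt0 n.
  apply/seteqP; split=> _ [x x01 <-].
    exists ((Lt n)%:R *: x); last by rewrite mulmx1.
    move=> i; have /andP[x0 x1] := x01 i; rewrite mxE mulr_ge0 ?(ltW L0)//=.
    by rewrite -[leRHS]mulr1 ler_pM2l.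
  exists ((Lt n)%:R^-1 *: x).
    move=> i; have /andP[x0 x1] := x01 i; rewrite mxE mulr_ge0 ?invr_ge0 ?(ltW L0)//=.
    by rewrite ler_pdivrMl// mulr1.
  by rewrite /block_map scalerA divff ?gt_eqF// scale1r mulmx1.
- move=> n; split.
    exists ((Lt n)%:R%:M), (offset k n) => x _.
    by rewrite mul_mx_scalar /block_map addrC.
  split=> [x x01|x y _ _|_ [x x01 <-]]; first by exists x.
    exact: block_map_inj.
  by exists x.
- move=> f cf [B [_ Bf]].
  have fB x : cube d 1 x -> `|f x| <= `|B| + 1.
    by move=> x01; apply: Bf => //; rewrite (le_lt_trans (ler_norm _))// ltrDl.
  pose a n := ((Lt n)%:R ^+ d)^-1 * \sum_(x <- block_pts n) f x.
  have mf := cube_continuous_measurable cf.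
  have -> : (fun n => \int[scaled_count (point_set (colouring N pat)) (block_map k n)
      (Lt n)%:R]_(x in cube d 1) (f x)%:E)%E = EFin \o a.
    apply/funext => n; apply: scaled_count_integral => //.
    + exact: block_pts_uniq.
    + by move=> x y _ _; exact: block_map_inj.
    + by move=> x; apply: mem_block_pts; exact: kE.
  have corner01 n (j : {ffun 'I_d -> 'I_(g n).+1}) : cube d 1 (cell_corner R j).
    by apply: (@cell_sub R d _ (ltn0Sn (g n)) j); exact: cell_corner_in.
  have near_cells e : 0 < e -> \forall n \near \oo,
      forall (j : {ffun 'I_d -> 'I_(g n).+1}) x, cell j x ->
        `|f x - f (cell_corner R j)| <= e.
    move=> e0; have [del del0 delP] := cube_unif_continuous cf e0.
    have [M Mdel] : exists M : nat, del^-1 < M%:R.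
      by exists (Num.truncn del^-1).+1; exact: Num.Theory.truncnS_gt.
    near=> n; move=> j x xj; rewrite distrC; apply/ltW/delP => //.
      exact: (@cell_sub R d _ (ltn0Sn (g n)) j).
    apply: cell_ball xj.
    have Mg : (M <= g n)%N by near: n; exact: g_infty.
    rewrite invf_plt ?posrE// (lt_le_trans Mdel)// ler_nat.
    exact: leq_trans Mg _.
  (* The limit integral is finite; any mesh on which f varies by at most 1 per cell shows it. *)
  have [J JE] : exists J : R,
      (\int[density_measure rho]_(x in cube d 1) (f x)%:E = J%:E)%E.
    near \oo => n.
    have fn : forall (j : {ffun 'I_d -> 'I_(g n).+1}) x, cell j x ->
        `|f x - f (cell_corner R j)| <= 1 by near: n; exact: near_cells.
    by have [J JE _] := density_integral rho_meas rho_bnd cf fn ler01; exists J.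
  rewrite JE; apply: cvg_EFin; first exact: nearW.
  apply/cvgrPdist_le => e e0.
  (* The errors add up to (5/3 + 2) e/8 + e/2 = 23e/24. *)
  have e40 : 0 < e / 8 by rewrite divr_gt0.
  have [M KM] : exists M : nat, (`|B| + 1) * (K%:R + 1) / (e / 2) < M%:R.
    by eexists; exact: Num.Theory.truncnS_gt.
  near=> n.
  have fn : forall (j : {ffun 'I_d -> 'I_(g n).+1}) x, cell j x ->
      `|f x - f (cell_corner R j)| <= e / 8 by near: n; exact: near_cells.
  have [J' J'E] := density_integral rho_meas rho_bnd cf fn (ltW e40).
  have {J'E}-> : J' = J by apply/EFin_inj; rewrite -J'E.
  move=> near_nu.
  have := sum_block_pts_near (ltW e40) fn (fun j => fB _ (corner01 n j)).
  have small : (`|B| + 1) * ((K%:R + 1) / (g n).+1%:R ^+ d) <= e / 2.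
    rewrite mulrA ler_pdivrMr ?exprn_gt0 ?ltr0n// -ler_pdivrMl ?divr_gt0// mulrC.
    apply: (le_trans (ltW KM)).
    have Mg : (M <= g n)%N by near: n; exact: g_infty.
    apply: (@le_trans _ _ (g n).+1%:R); first by rewrite ler_nat ltnW.
    by rewrite ler_eXnr// ler1n.
  rewrite -/(a n) -[(fine \o _) n]/(a n); move: small.
  move: ((`|B| + 1) * _) => t te; rewrite !ler_norml.
  by move: near_nu; rewrite ler_norml => /andP[? ?] /andP[? ?]; apply/andP; split; lra.
Unshelve. all: by end_near. Qed.

End Encoding.

(** * The parameters and the theorem *)

Section BranchingNumbers.
Variables (R : realType) (d : nat).
Hypothesis d_gt0 : (0 < d)%N.
Local Notation K := #|{: slot d}|.

Lemma branching_exists : exists (g : nat -> nat) (C : R),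
  [/\ forall n, big_enough d (branching g n),
      forall n, \sum_(i < n) K%:R / (branching g i)%:R ^+ d <= 1 / 3 :> R,
      forall n, (n < branching g n ^ d)%N,
      forall n, (branching g n)%:R ^+ d <= C * weight R n
    & forall M, \forall n \near \oo, (M <= g n)%N].
Proof.
(* [N n] is the square of the least h with h^(2d) >= c [weight n]. The summand [M] of c ensures
   [big_enough]; the summand 5K bounds the sum of K / N_i^d by (1/5)(3/2) = 3/10. *)
pose M := (#|{: tile_cluster d}|.*2.+2 ^ d)%N.
pose c : R := 5 * K%:R + M%:R.
have K1 : 1 <= K%:R :> R.
  by rewrite ler1n; apply/card_gt0P; exists (None, [ffun=> false]).
have M0 : 0 <= M%:R :> R by [].
have w1 n : 16 / 9 <= weight R n.
  apply: le_trans (weight_ge R n).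
  have : 4 <= n.+4%:R :> R by rewrite ler_nat.
  lra.
have cw1 n : 1 <= c * weight R n by have := w1 n; rewrite /c; nra.
have d20 : (0 < 2 * d)%N by rewrite muln_gt0.
have /choice[h hP] n := even_root_exists d20 (cw1 n).
have h0 n : (0 < h n)%N.
  rewrite lt0n; apply/eqP => h0; have [+ _] := hP n.
  by rewrite h0 expr0n (gtn_eqF d20)/=; have := cw1 n; lra.
exists (fun n => (h n).-1), (2 ^+ (2 * d) * c).
have NE n : (branching (fun n => (h n).-1) n)%:R ^+ d = (h n)%:R ^+ (2 * d) :> R.
  by rewrite /branching prednK// natrX -exprM.
set N := branching _ in NE *.
have N_lo n : c * weight R n <= (N n)%:R ^+ d by rewrite NE; exact: (hP n).1.
have N_gt n : (n < N n ^ d)%N.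
  rewrite -(ltr_nat R) natrX; apply: lt_le_trans (N_lo n).
  apply: (@lt_le_trans _ _ (5 * (n.+4%:R * (4 / 9)))).
    have -> : n.+4%:R = n%:R + 4 :> R by rewrite -natrD addn4.
    by have := ler0n R n; lra.
  have := weight_ge R n; have := weight_gt0 R n; rewrite /c.
  by have : 0 <= n.+4%:R :> R := ler0n _ _; nra.
split=> // [n|n|n|m].
- rewrite /big_enough -(leq_exp2r _ _ d_gt0) -(ler_nat R) [leRHS]natrX.
  apply: le_trans (N_lo n); rewrite -/M /c; have := w1 n; nra.
- apply: (@le_trans _ _ (\sum_(i < n) 5^-1 * (weight R i)^-1)).
    apply: ler_sum => i _; have wi := weight_gt0 R i.
    have K0 : 0 < K%:R :> R by lra.
    apply: (@le_trans _ _ (K%:R / (5 * K%:R * weight R i))).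
      have Ni : 0 < (N i)%:R ^+ d :> R.
        by apply: lt_le_trans (N_lo i); have := cw1 i; lra.
      have Kw : 0 < 5 * K%:R * weight R i by apply: mulr_gt0 => //; apply: mulr_gt0.
      rewrite ler_pM2l// lef_pV2 ?posrE//.
      by apply: le_trans (N_lo i); rewrite /c; nra.
    by rewrite le_eqVlt; apply/orP; left; apply/eqP; field; rewrite !gt_eqF.
  by rewrite -mulr_sumr; have := sum_weight_le R n; lra.
- by rewrite NE -mulrA; exact: (hP n).2.
(* If g n < m, then h n <= m and N_n^d = (h n)^(2d) <= m^(2d) <= n, against n < N_n^d. *)
- exists (m ^ (2 * d))%N => // n /= mn.
  rewrite leqNgt; apply/negP => hm.
  have hm' : (h n <= m)%N by rewrite -(prednK (h0 n)).
  have := N_gt n; rewrite ltnNge => /negP; apply; apply: leq_trans mn.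
  rewrite -(ler_nat R) [leLHS]natrX NE -natrX ler_nat.
  by rewrite leq_exp2r.
Qed.

End BranchingNumbers.

Section RepetitivityFunction.
Variables (R : realType) (d : nat) (N : nat -> nat).
Variable pat : nat -> (tile -> 'rV[int]_d -> bool) -> 'rV[int]_d -> bool.
Hypothesis d_gt0 : (0 < d)%N.
Hypothesis N_big : forall n, big_enough d (N n).

Lemma level_exists : exists lev : R -> nat,
  (forall r, 2 * r + 1 <= (side N (lev r))%:R) /\
  (forall r n, 2 * r + 1 <= (side N n)%:R -> (lev r <= n)%N).
Proof.
have ex (r : R) : exists n, 2 * r + 1 <= (side N n)%:R.
  have [n rn] : exists n : nat, 2 * r + 1 < n%:R.
    by eexists; exact: Num.Theory.truncnS_gt.
  exists n; apply: le_trans (ltW rn) _.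
  by rewrite ler_nat ltnW// (side_gt N_big).
exists (fun r => ex_minn (ex r)); split=> r; first by case: ex_minnP.
by move=> n rn; case: ex_minnP => m _; apply.
Qed.

Lemma repetitivity_colouring (lev : R -> nat) :
  (forall r, 2 * r + 1 <= (side N (lev r))%:R) ->
  (forall r n, 2 * r + 1 <= (side N n)%:R -> (lev r <= n)%N) ->
  repetitivity_function (@point_set R d (colouring N pat))
    (fun r => (d%:R + 1) * (side N (lev r).+1)%:R).
Proof.
move=> lev_ge lev_min; split=> [r r0|r s r0 rs|r r0 x Xx y].
- by rewrite mulr_gt0 ?ltr_wpDl// ltr0n (side_gt0 N_big).
- rewrite ler_pM2l ?ltr_wpDl// ler_nat (side_le N_big)// ltnS lev_min//.
  by apply: le_trans (lev_ge s); lra.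
- exact: patch_recur.
Qed.

End RepetitivityFunction.

Theorem theorem1p4 (R : realType) (d : nat) (hd : (2 <= d)%N)
    (rho : lebesgueType R d -> R)
    (rho_meas : measurable_fun (cube d 1 : set (lebesgueType R d)) rho)
    (rho_bnd : forall x, cube d 1 x -> 4 / 3 <= rho x <= 5 / 3) :
  exists X : set 'rV[R]_d,
    [/\ delone X, repetitive X, encodes X rho
      & exists2 Rf : R -> R, repetitivity_function X Rf
        & forall q : R, 2 / d%:R < q ->
          Rf r / (r * (ln r / ln (ln r)) `^ q) @[r --> +oo] --> (0 : R)].
Proof.
have d_gt0 : (0 < d)%N by exact: ltnW.
have [g [C [N_big N_sum N_gt N_le g_infty]]] := branching_exists R d_gt0.
have [lev [lev_ge lev_min]] := level_exists R N_big.
pose pat := mixed_pattern g (target rho g).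
have rep : repetitivity_function (@point_set R d (colouring (branching g) pat))
    (fun r => (d%:R + 1) * (side (branching g) (lev r).+1)%:R).
  exact: repetitivity_colouring.
exists (point_set (colouring (branching g) pat)); split.
- exact: delone_point_set.
- by exists (fun r => (d%:R + 1) * (side (branching g) (lev r).+1)%:R).
- exact: encodes_colouring.
- exists (fun r => (d%:R + 1) * (side (branching g) (lev r).+1)%:R) => // q dq.
  exact: growth_cvg.
Qed.
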